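(* Suppose that $d\in\{1,2,3\}$ and let $0<\sigma<1$ be such that $0<\frac d2-\sigma<1$. Let $g$ be a Schwartz function on $\mathbb{R}^d$. Then a solution to the Neumann problem $$\begin{cases}\partial_t^2u+\frac{1-2\sigma}{t}\partial_tu=\Delta u,\\ u(\cdot,0)=0,\quad\partial_t^\sigma u(\cdot,0)=g\end{cases}$$ is given, for $x\in\mathbb{R}^d$ and $t>0$, by $$u(x,t)=\frac{\sigma\sin\big((\frac d2-\sigma)\pi\big)\Gamma(\frac d2-\sigma)}{\pi^{\frac d2}\sin(\sigma\pi)\Gamma(1-\sigma)}\int_{B(x,t)}\frac{g(y)}{(t^2-|x-y|^2)^{\frac d2-\sigma}}\,dy .$$
   Context: $\partial_t^\sigma=\frac{1}{2\sigma}t^{1-2\sigma}\partial_t$; $\Delta$ is the Laplacian in $x\in\mathbb{R}^d$; $B(x,t)$ is the open ball with centre $x$ and radius $t$. The equation is to hold for all $x\in\mathbb{R}^d$ and $t>0$, and the initial values are understood as limits as $t\to0^+$ (for each $x$): $u(x,t)\to0$ and $\partial_t^\sigma u(x,t)\to g(x)$. *)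

(* Defs.v *)
From HB Require Import structures.
From mathcomp Require Import all_boot all_order all_algebra.
From mathcomp Require Import all_classical all_reals all_analysis.
From mathcomp Require Export complex.

Set Implicit Arguments.
Unset Strict Implicit.
Unset Printing Implicit Defensive.

Import Order.TTheory GRing.Theory Num.Theory.
Import numFieldNormedType.Exports.

Local Open Scope classical_set_scope.
Local Open Scope ring_scope.
Local Open Scope complex_scope.

Section lebesgue_tuple.
Context {R : realType}.

Definition pair_cons n (p : measurableTypeR R * n.-tuple R) : n.+1.-tuple R :=
  [tuple of p.1 :: p.2].

Lemma measurable_pair_cons n : measurable_fun setT (@pair_cons n).
Proof. exact: measurable_cons. Qed.

Section lebesgue_cons.
Variables (n : nat) (m : {sigma_finite_measure set (n.-tuple R) -> \bar R}).

Definition lebesgue_cons : set (n.+1.-tuple R) -> \bar R :=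
  pushforward (lebesgue_measure \x m)%E (@pair_cons n).

Let lebesgue_cons0 : lebesgue_cons set0 = 0%E.
Proof. by rewrite /lebesgue_cons /pushforward preimage_set0 measure0. Qed.

Let lebesgue_cons_ge0 A : (0 <= lebesgue_cons A)%E.
Proof. by rewrite /lebesgue_cons /pushforward; apply: measure_ge0. Qed.

Let lebesgue_cons_sigma_additive : semi_sigma_additive lebesgue_cons.
Proof.
move=> F mF tF mUF; rewrite /lebesgue_cons /pushforward preimage_bigcup.
apply: measure_semi_sigma_additive.
- by move=> k; rewrite -[X in measurable X]setTI; exact: measurable_pair_cons.
- apply/trivIsetP => /= i j _ _ ij; rewrite -preimage_setI.
  by move/trivIsetP : tF => /(_ _ _ _ _ ij) ->//; rewrite preimage_set0.
- rewrite -preimage_bigcup -[X in measurable X]setTI.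
  exact: measurable_pair_cons.
Qed.

HB.instance Definition _ := isMeasure.Build _ _ _ lebesgue_cons
  lebesgue_cons0 lebesgue_cons_ge0 lebesgue_cons_sigma_additive.

Let lebesgue_cons_sigma_finite : sigma_finite setT lebesgue_cons.
Proof.
pose split (t : n.+1.-tuple R) : measurableTypeR R * n.-tuple R :=
  (thead t, [tuple of behead t]).
have msplit : measurable_fun setT split.
  apply: measurable_fun_pair; first exact: measurable_tnth.
  apply/measurable_fun_tnthP => i.
  rewrite (_ : _ \o _ = fun t : n.+1.-tuple R => tnth t (lift ord0 i)).
    exact: measurable_tnth.
  by apply/funext => t /=; rewrite tnth_behead; congr tnth; apply: val_inj; rewrite /= inordK ?ltnS.
have splitK : cancel (@pair_cons n) split.
  move=> [x y]; rewrite /split /pair_cons /=; congr pair.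
  by apply: val_inj.
have /sigma_finiteP[F [TF ndF Foo]] :
  sigma_finite setT (@lebesgue_measure R) by exact: sigma_finiteT.
have /sigma_finiteP[G [TG ndG Goo]] := sigma_finiteT m.
exists (fun k => split @^-1` (F k `*` G k)).
  rewrite -preimage_bigcup (_ : \bigcup_k _ = setT) ?preimage_setT//.
  rewrite -subTset => -[x y] _.
  have [i _ Fx] : (\bigcup_k F k) x by rewrite -TF.
  have [j _ Gy] : (\bigcup_k G k) y by rewrite -TG.
  exists (maxn i j) => //; split.
  - by move: Fx; exact/subsetPset/ndF/leq_maxl.
  - by move: Gy; exact/subsetPset/ndG/leq_maxr.
move=> k; have [mF Fk] := Foo k; have [mG Gk] := Goo k; split.
  by rewrite -[X in measurable X]setTI; apply: msplit => //; exact: measurableX.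
rewrite /lebesgue_cons /pushforward -comp_preimage.
rewrite (_ : split \o _ = id) ?preimage_id; last first.
  by apply/funext => p; exact: splitK.
by rewrite product_measure1E// lte_mul_pinfty// ge0_fin_numE.
Qed.

HB.instance Definition _ := Measure_isSigmaFinite.Build _ _ _ lebesgue_cons
  lebesgue_cons_sigma_finite.

End lebesgue_cons.

(* The n-fold product of the Lebesgue measure on R, i.e. the Lebesgue measure
   on (the Borel sets of) R^n. *)
Fixpoint lebesgue_tuple n : {sigma_finite_measure set (n.-tuple R) -> \bar R} :=
  match n with
  | 0 => dirac [tuple]
  | k.+1 => lebesgue_cons (lebesgue_tuple k)
  end.

End lebesgue_tuple.

Section complex_valued.
Context {R : realType}.

(* Limits, real-direction derivatives and integrals of R[i]-valued functions
   are taken componentwise, R[i] being identified with R^2. *)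
Section derivative.
Context {V : normedModType R}.
Implicit Types (f : V -> R[i]) (x v : V).

Definition cdifferentiable f x : Prop :=
  differentiable (fun y => complex.Re (f y)) x /\
  differentiable (fun y => complex.Im (f y)) x.

Definition cderivable f x v : Prop :=
  derivable (fun y => complex.Re (f y)) x v /\
  derivable (fun y => complex.Im (f y)) x v.

Definition cderive f v x : R[i] :=
  'D_v (fun y => complex.Re (f y)) x +i* 'D_v (fun y => complex.Im (f y)) x.

End derivative.

Definition ccvg_to {T : Type} (F : set_system T) (f : T -> R[i]) (l : R[i]) :=
  complex.Re (f y) @[y --> F] --> complex.Re l /\
  complex.Im (f y) @[y --> F] --> complex.Im l.

Definition dt (f : R -> R[i]) : R -> R[i] := cderive f 1.

Section euclidean_space.
Context {d : nat}.
Implicit Types (x : 'rV[R]_d) (f g : 'rV[R]_d -> R[i]).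

Definition partial (i : 'I_d) f : 'rV[R]_d -> R[i] := cderive f (delta_mx 0 i).

Definition laplacian f x : R[i] := \sum_(i < d) partial i (partial i f) x.

Definition iter_partial (s : seq 'I_d) f : 'rV[R]_d -> R[i] :=
  foldr partial f s.

(* s ranges over all finite sequences of coordinate directions, hence over all
   iterated partial derivatives. *)
Definition schwartz g : Prop :=
  (forall s x, cdifferentiable (iter_partial s g) x) /\
  (forall (alpha : 'I_d -> nat) (s : seq 'I_d), exists C : R, forall x,
     `| (\prod_(i < d) x 0 i ^+ alpha i)%:C * iter_partial s g x | <= C%:C).

(* The library's norm on 'rV[R]_d is the sup norm. *)
Definition eucl_norm x : R := Num.sqrt (\sum_(i < d) x 0 i ^+ 2).

Definition eucl_ball x (t : R) : set 'rV[R]_d :=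
  [set y | eucl_norm (x - y) < t].

(* 'rV[R]_d carries the topology but no measurable structure: sets and
   functions on it are pulled back to d.-tuple R for integration. *)
Definition row_of_tuple (y : d.-tuple R) : 'rV[R]_d := \row_i tnth y i.

Definition cintegrable (D : set 'rV[R]_d) f : Prop :=
  let D' := row_of_tuple @^-1` D in
  (lebesgue_tuple d).-integrable D'
    (fun y => (complex.Re (f (row_of_tuple y)))%:E) /\
  (lebesgue_tuple d).-integrable D'
    (fun y => (complex.Im (f (row_of_tuple y)))%:E).

Definition cintegral (D : set 'rV[R]_d) f : R[i] :=
  let D' := row_of_tuple @^-1` D in
  (\int[lebesgue_tuple d]_(y in D') complex.Re (f (row_of_tuple y))) +i*
  (\int[lebesgue_tuple d]_(y in D') complex.Im (f (row_of_tuple y))).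

Definition dt_sigma (sigma : R) (f : R -> R[i]) (t : R) : R[i] :=
  ((2 * sigma)^-1 * t `^ (1 - 2 * sigma))%:C * dt f t.

(* Only the values of u at times t > 0 matter. *)
Definition neumann_solution (sigma : R) g (u : 'rV[R]_d -> R -> R[i]) : Prop :=
  [/\ forall x t, 0 < t ->
        [/\ cderivable (u x) t 1, cderivable (dt (u x)) t 1,
            forall i, cderivable (u^~ t) x (delta_mx 0 i)
          & forall i, cderivable (partial i (u^~ t)) x (delta_mx 0 i)],
      forall x t, 0 < t ->
        dt (dt (u x)) t + ((1 - 2 * sigma) / t)%:C * dt (u x) t =
        laplacian (u^~ t) x,
      forall x, ccvg_to 0^'+ (u x) 0
    & forall x, ccvg_to 0^'+ (dt_sigma sigma (u x)) (g x)].

End euclidean_space.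
End complex_valued.

(* Meaningful for s > 0 only. *)
Definition Gamma {R : realType} (s : R) : R :=
  \int[lebesgue_measure]_(x in `]0, +oo[) (x `^ (s - 1) * expR (- x)).

(* Main.v *)
Require Import Defs.
From mathcomp Require Import all_boot all_order all_algebra.
From mathcomp Require Import all_classical all_reals all_analysis.
From mathcomp Require Import measurable_realfun ring lra.
Import Order.TTheory GRing.Theory Num.Theory.
Import numFieldNormedType.Exports.
Set Implicit Arguments.
Unset Strict Implicit.
Unset Printing Implicit Defensive.
Local Open Scope classical_set_scope.
Local Open Scope ring_scope.
Local Open Scope complex_scope.


(** The substitution y = x + t z turns the proposed solution into
    u(x,t) = c t^(2 sigma) M(x,t), where M(x,t) is the integral of
    g(x + t z) w(z) over the unit ball and w(z) = (1 - |z|^2)^(-a); the power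
    of t is d - 2a = 2 sigma. Here x and t occur only inside g, so M can be
    differentiated under the integral sign ([is_derive_integral_line]), and
    the singularity of the kernel on the boundary of the ball never moves.

    Wave equation. In terms of M it reads
    M_tt + (1 + 2 sigma) / t M_t = Delta M. Let W(z) = (1 - |z|^2)^(1-a). Since
    W vanishes on the unit sphere and has gradient - 2(1-a) z w(z), every smooth
    H satisfies 2(1-a) int z_i H w = int (d_i H) W ([weight_by_parts]): on a
    chord parallel to the i-th axis this is the fundamental theorem of calculus
    for H W, whose derivative is singular but integrable. This is applied to all
    the integrals with a factor z_i, those of M_t and M_tt as well as those
    produced by w = W + |z|^2 w in Delta M. Both sides become combinations of
    int (Delta g) W and int (z . grad Delta g) W, and the coefficients agree
    because 2 + 2 sigma = 2(1-a) + d ([darboux_integral]); the symmetry of mixed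
    derivatives ([dpartC]) is what makes the third derivatives match.

    Initial values. M is differentiable up to t = 0 and M(x,0) = K g(x) with
    K = int w, so u tends to 0, and (2 sigma)^(-1) t^(1 - 2 sigma) u_t =
    c M + c / (2 sigma) t M_t tends to c K g(x). Integrating
    exp(-r) (r - |y|^2)^(-a) over the region |y|^2 < r in both orders gives
    K Gamma(sigma + 1) = pi^(d/2) Gamma(1-a) ([integral_weight]). Hence c K is
    the quotient of the values of sin(pi s) Gamma(s) Gamma(1-s) at s = a and at
    s = sigma, which is 1 by Euler's reflection formula.

    Reflection formula. Let P_n be the product of the 1 - s^2 / k^2 for
    1 <= k <= n. The moments int_0^(pi/2) cos(2 s x) cos(x)^(2n) dx satisfy a
    recurrence in n which shows that sin(pi s) / (pi s) is P_n times a ratio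
    tending to 1, because cos^(2n) concentrates at 0. The functional equation
    of Gamma shows that Gamma(1+s) Gamma(1-s) P_n is
    Gamma(n+1+s) Gamma(n+1-s) / n!^2, which tends to 1 by convexity. The product
    P_n cancels, and no infinite product is needed.

    A complex-valued g is handled through its real and imaginary parts. *)

(** * Improper integrals and the fundamental theorem of calculus *)

Lemma is_derive_cvg (R : realType) (f : R -> R) (x df : R) :
  is_derive x 1 f df -> f y @[y --> x] --> f x.
Proof. by case=> /derivable1_diffP /differentiable_continuous. Qed.

Lemma integrable_scale d (T : measurableType d) (R : realType)
    (mu : {measure set T -> \bar R}) (D : set T) (k : R) (f : T -> R) :
  measurable D -> mu.-integrable D (EFin \o f) ->
  mu.-integrable D (EFin \o (fun x => k * f x)).
Proof.
move=> mD intf; rewrite (_ : EFin \o _ = (fun x => k%:E * (EFin \o f) x))%E.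
  exact: integrableZl.
by apply/funext => x /=; rewrite EFinM.
Qed.

Lemma integrable_add d (T : measurableType d) (R : realType)
    (mu : {measure set T -> \bar R}) (D : set T) (f g : T -> R) :
  measurable D -> mu.-integrable D (EFin \o f) ->
  mu.-integrable D (EFin \o g) ->
  mu.-integrable D (EFin \o (fun x => f x + g x)).
Proof.
move=> mD intf intg.
rewrite (_ : EFin \o _ = (EFin \o f) \+ (EFin \o g))%E.
  exact: integrableD.
by apply/funext => x /=; rewrite EFinD.
Qed.

(** The positive and the negative part obey monotone convergence separately;
    integrability makes their difference meaningful. *)
Lemma integrable_nondecreasing_set_cvg_integral d (T : measurableType d)
    (R : realType) (mu : {measure set T -> \bar R}) (F : (set T)^nat)
    (f : T -> \bar R) :
  {homo F : n m / (n <= m)%N >-> (n <= m)%O} ->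
  (forall n, measurable (F n)) ->
  mu.-integrable (\bigcup_n F n) f ->
  (\int[mu]_(x in F n) f x)%E @[n --> \oo] -->
    (\int[mu]_(x in \bigcup_n F n) f x)%E.
Proof.
move=> ndF mF intf; have mUF := bigcup_measurable (fun n _ => mF n).
have mfn n : measurable_fun (F n) f.
  apply: measurable_funS (measurable_int _ intf) => //.
  exact: bigcup_sup.
rewrite [X in _ --> X]integralE; under eq_fun do rewrite integralE.
apply: cvgeB.
- apply: fin_num_adde_defr; apply: integrable_fin_num => //.
  exact: integrable_funepos.
- apply: ge0_nondecreasing_set_cvg_integral => // n.
  exact: measurable_funepos.
- apply: ge0_nondecreasing_set_cvg_integral => // n.
  exact: measurable_funeneg.
Qed.

Section improper_ftc.
Context {R : realType}.
Notation mu := (@lebesgue_measure R).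
Implicit Types (f F : R -> R) (a b : R).

(* The denominator starts at 3 so that the two gaps never overlap. *)
Let gap a b (n : nat) : R := (b - a) / (n + 3)%:R.

Let shrink a b (n : nat) : set R := `[a + gap a b n, b - gap a b n].

Let gap_gt0 a b n : a < b -> 0 < gap a b n.
Proof. by move=> ab; rewrite divr_gt0 ?subr_gt0// ltr0n addn3. Qed.

Let gap_lt a b n : a < b -> a + gap a b n < b - gap a b n.
Proof.
move=> ab; suff : gap a b n * 2 < b - a by lra.
rewrite /gap mulrAC ltr_pdivrMr ?ltr0n ?addn3// ltr_pM2l ?subr_gt0//.
by rewrite ltr_nat.
Qed.

Let gap_cvg0 a b : gap a b n @[n --> \oo] --> 0.
Proof.
rewrite /gap -(mulr0 (b - a)).
apply: cvgM; first exact: cvg_cst.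
apply/gtr0_cvgV0; first by near=> n; rewrite ltr0n addn3.
apply/cvgryPge => A; near=> n; apply: (@le_trans _ _ n%:R).
  by near: n; exact: nbhs_infty_ger.
by rewrite ler_nat leq_addr.
Unshelve. all: by end_near. Qed.

Let shrinkE a b : a < b -> \bigcup_n shrink a b n = `]a, b[%classic.
Proof.
move=> ab; apply/seteqP; split => [x [n _]|x].
  rewrite /shrink /= !in_itv /= => /andP[h1 h2].
  have := gap_gt0 n ab.
  by move=> e0; apply/andP; split; lra.
rewrite /= in_itv/= => /andP[ax xb].
pose m := Num.min (x - a) (b - x).
have m0 : 0 < m by rewrite /m lt_min !subr_gt0 ax.
have [n _ hn] : \forall n \near \oo, gap a b n <= m.
  have /cvgrPdist_le := gap_cvg0 a b.
  move=> /(_ _ m0); apply: filterS => n /=.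
  by rewrite sub0r normrN ger0_norm// ltW// gap_gt0.
exists n => //; rewrite /shrink /= in_itv /=.
have := hn n (leqnn n); rewrite /= /m le_min => /andP[h1 h2].
by apply/andP; split; lra.
Qed.

Let shrink_homo a b : a < b ->
  {homo shrink a b : n m / (n <= m)%N >-> (n <= m)%O}.
Proof.
move=> ab n m nm; apply/subsetPset => x; rewrite /shrink/= !in_itv/=.
have : gap a b m <= gap a b n.
  rewrite /gap ler_pM2l ?subr_gt0// lef_pV2 ?posrE ?ltr0n ?addn3//.
  by rewrite ler_nat.
by move=> g /andP[h1 h2]; apply/andP; split; lra.
Qed.

Let shrink_sub a b n : a < b -> shrink a b n `<=` `]a, b[%classic.
Proof. by move=> ab; rewrite -shrinkE// => x ?; exists n. Qed.

Let mshrink a b n : measurable (shrink a b n).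
Proof. exact: measurable_itv. Qed.

Let FTC_shrink f F a b n : a < b ->
  (forall x, a < x < b -> is_derive x 1 F (f x)) ->
  {in `]a, b[, continuous f} ->
  (\int[mu]_(x in shrink a b n) (f x)%:E =
   (F (b - gap a b n) - F (a + gap a b n))%:E)%E.
Proof.
move=> ab dF cf; rewrite EFinB.
have sub x : x \in `[a + gap a b n, b - gap a b n] -> a < x < b.
  by move=> xs; have := @shrink_sub a b n ab x xs; rewrite /= in_itv.
have dFx x : x \in `[a + gap a b n, b - gap a b n] -> derivable F x 1.
  by move=> /sub/dF [].
apply: continuous_FTC2; first exact: gap_lt.
- apply: continuous_in_subspaceT => x; rewrite inE => /sub xab.
  by apply: cf; rewrite in_itv.
- have cF x : a < x < b -> {for x, continuous F}.
    by move=> /dF; exact: is_derive_cvg.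
  have := gap_gt0 n ab; have := gap_lt n ab => g1 g2.
  split.
  + by move=> x xs; apply: dFx; apply: subset_itv_oo_cc.
  + by apply: cvg_at_right_filter; apply: cF; apply/andP; split; lra.
  + by apply: cvg_at_left_filter; apply: cF; apply/andP; split; lra.
- move=> x /subset_itv_oo_cc/sub/dF[_ <-].
  by rewrite derive1E.
Qed.

Let cvg_shrink F a b : a < b ->
  F x @[x --> a^'+] --> F a -> F x @[x --> b^'-] --> F b ->
  (F (b - gap a b n) - F (a + gap a b n))%:E @[n --> \oo]
    --> (F b - F a)%:E.
Proof.
move=> ab Fa Fb; apply: cvg_EFin; first exact: nearW.
apply: cvgB.
- move/cvg_at_leftP : Fb; apply; split; first by move=> n; have := gap_gt0 n ab; lra.
  by rewrite -[X in _ --> X]subr0; apply: cvgB; [exact: cvg_cst|exact: gap_cvg0].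
- move/cvg_at_rightP : Fa; apply; split; first by move=> n; have := gap_gt0 n ab; lra.
  by rewrite -[X in _ --> X]addr0; apply: cvgD; [exact: cvg_cst|exact: gap_cvg0].
Qed.

Let mfoo f a b : {in `]a, b[, continuous f} ->
  measurable_fun `]a, b[%classic f.
Proof.
move=> cf; apply: open_continuous_measurable_fun => //.
exact/in_continuous_mksetP.
Qed.

(** The derivative may blow up at both ends of the interval: the classical
    theorem holds on compact subintervals, and these exhaust the open interval.
    With f nonnegative, integrability is part of the conclusion. *)
Lemma ge0_continuous_FTC2_oo f F a b : a < b ->
  (forall x, a < x < b -> 0 <= f x) ->
  {in `]a, b[, continuous f} ->
  (forall x, a < x < b -> is_derive x 1 F (f x)) ->
  F x @[x --> a^'+] --> F a -> F x @[x --> b^'-] --> F b ->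
  (\int[mu]_(x in `]a, b[) (f x)%:E = (F b - F a)%:E)%E.
Proof.
move=> ab f0 cf dF Fa Fb.
rewrite -(shrinkE ab).
have h : (\int[mu]_(x in shrink a b i) (f x)%:E)%E @[i --> \oo] -->
    (\int[mu]_(x in \bigcup_i shrink a b i) (f x)%:E)%E.
  apply: ge0_nondecreasing_set_cvg_integral.
  - exact: shrink_homo.
  - by move=> i; exact: mshrink.
  - move=> i; apply: (@measurable_funS _ _ _ _ `]a, b[%classic) => //.
      exact: shrink_sub.
    by apply/measurable_EFinP; exact: mfoo.
  - move=> i x /(shrink_sub ab); rewrite /= in_itv/= lee_fin; exact: f0.
rewrite -(cvg_lim _ h)//; apply/cvg_lim => //.
under eq_fun do rewrite (FTC_shrink _ ab dF cf).
exact: cvg_shrink.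
Qed.

Lemma integrable_FTC2_oo f F a b : a < b ->
  mu.-integrable `]a, b[ (EFin \o f) ->
  {in `]a, b[, continuous f} ->
  (forall x, a < x < b -> is_derive x 1 F (f x)) ->
  F x @[x --> a^'+] --> F a -> F x @[x --> b^'-] --> F b ->
  (\int[mu]_(x in `]a, b[) (f x)%:E = (F b - F a)%:E)%E.
Proof.
move=> ab intf cf dF Fa Fb.
have h : (\int[mu]_(x in shrink a b i) (f x)%:E)%E @[i --> \oo] -->
    (\int[mu]_(x in `]a, b[) (f x)%:E)%E.
  rewrite -(shrinkE ab); apply: integrable_nondecreasing_set_cvg_integral.
  - exact: shrink_homo.
  - by move=> i; exact: mshrink.
  - by rewrite shrinkE.
rewrite -(cvg_lim _ h)//; apply/cvg_lim => //.
under eq_fun do rewrite (FTC_shrink _ ab dF cf).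
exact: cvg_shrink.
Qed.

End improper_ftc.

(** * The Gamma function *)

Section gamma.
Context {R : realType}.
Notation mu := (@lebesgue_measure R).
Implicit Types s x y : R.

Lemma integral_powR x s : 0 < x -> 0 < s ->
  (\int[mu]_(y in `]0%R, x[) (s * y `^ (s - 1))%:E = (x `^ s)%:E)%E.
Proof.
move=> x0 s0.
have -> : x `^ s = x `^ s - 0 `^ s by rewrite powR0 ?subr0// gt_eqF.
apply: (@ge0_continuous_FTC2_oo _ _ (fun y => y `^ s)) => //.
- by move=> y _; rewrite mulr_ge0 ?powR_ge0// ltW.
- move=> y; rewrite in_itv/= => /andP[y0 _].
  apply: cvgM; first exact: cvg_cst.
  exact: is_derive_cvg (is_derive1_powR (s - 1) y0).
- by move=> y /andP[y0 _]; exact: is_derive1_powR.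
- by rewrite powR0 ?gt_eqF//; exact: powR_cvg0.
- exact/cvg_at_left_filter/is_derive_cvg/is_derive1_powR.
Qed.

Lemma integral_expR_tail y :
  (\int[mu]_(x in `]y, +oo[) (expR (- x))%:E = (expR (- y))%:E)%E.
Proof.
have dF x : is_derive x 1 (fun x => - expR (- x)) (expR (- x)).
  by apply: is_derive_eq; rewrite mulrN1 opprK.
have cF : continuous (fun x : R => - expR (- x)).
  by move=> x; exact: is_derive_cvg.
have ce : continuous (fun x : R => expR (- x)).
  by move=> x; exact: is_derive_cvg.
rewrite integral_itv_obnd_cbnd; last first.
  by apply/measurable_EFinP; apply: measurable_funTS; exact: continuous_measurable_fun.
rewrite (@ge0_continuous_FTC2y _ _ (fun x => - expR (- x)) _ 0).
- by rewrite sub0e EFinN oppeK.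
- by move=> x _; exact: expR_ge0.
- by apply: continuous_subspaceT.
- by rewrite -oppr0; apply: cvgN; exact: cvgr_expR.
- by move=> x _; case: (dF x).
- exact/cvg_at_right_filter/cF.
- by move=> x _; rewrite derive1E; case: (dF x).
Qed.

Definition gamma_fun s x : R := x `^ (s - 1) * expR (- x).

(** The extended-real integral behind [Gamma]; finiteness comes later, from the
    functional equation. *)
Definition eGamma s : \bar R := (\int[mu]_(x in `]0%R, +oo[) (gamma_fun s x)%:E)%E.

Lemma GammaE s : Gamma s = fine (eGamma s).
Proof. by []. Qed.

Lemma gamma_fun_ge0 s x : 0 <= gamma_fun s x.
Proof. by rewrite mulr_ge0 ?powR_ge0 ?expR_ge0. Qed.

Lemma measurable_expRN : measurable_fun setT (fun x : R => expR (- x)).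
Proof. by apply: measurableT_comp => //; exact: measurable_expR. Qed.

Lemma measurable_gamma_fun s : measurable_fun setT (gamma_fun s).
Proof.
apply: measurable_funM; first exact: measurable_powR.
exact: measurable_expRN.
Qed.

Lemma eGamma_ge0 s : (0 <= eGamma s)%E.
Proof. by apply: integral_ge0 => x _; rewrite lee_fin gamma_fun_ge0. Qed.

(** Tonelli's theorem on the region 0 < y < x applied to s y^(s-1) exp(-x):
    integrating over y first gives x^s exp(-x), over x first s y^(s-1) exp(-y).
    Working with extended reals, finiteness need not be known in advance. *)
Lemma eGammaS s : 0 < s -> eGamma (s + 1) = (s%:E * eGamma s)%E.
Proof.
move=> s0.
pose f (p : R * R) : \bar R :=
  if (0 < p.2) && (p.2 < p.1) then (s * p.2 `^ (s - 1) * expR (- p.1))%:E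
  else 0%E.
have f0 p : (0 <= f p)%E.
  rewrite /f; case: ifPn => // _.
  by rewrite lee_fin !mulr_ge0 ?powR_ge0 ?expR_ge0// ltW.
have mf : measurable_fun setT f.
  apply: measurable_fun_ifT => //.
  - by apply: measurable_and; apply: measurable_fun_ltr.
  - apply/measurable_EFinP; apply: measurable_funM.
      apply: measurable_funM => //.
      exact: measurableT_comp (measurable_powR _) measurable_snd.
    exact: measurableT_comp measurable_expRN measurable_fst.
transitivity (\int[mu]_x \int[mu]_y f (x, y))%E; last first.
  rewrite fubini_tonelli// /eGamma -ge0_integralZl//=; last 3 first.
  - by apply/measurable_EFinP; apply: measurable_funTS; exact: measurable_gamma_fun.
  - by move=> x _; rewrite lee_fin gamma_fun_ge0.
  - by rewrite lee_fin ltW.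
  rewrite [RHS]integral_mkcond; apply: eq_integral => y _.
  rewrite patchE mem_setE in_itv/= andbT; case: ifPn => [y0|]; last first.
    by move=> /negbTE y0; apply: integral0_eq => x _; rewrite /f /= y0.
  rewrite [RHS](_ : _ = (s * y `^ (s - 1))%:E * (expR (- y))%:E)%E; last first.
    by rewrite /gamma_fun -!EFinM mulrA.
  rewrite -integral_expR_tail -ge0_integralZl//=; last 2 first.
  - apply/measurable_EFinP; apply: measurable_funTS; exact: measurable_expRN.
  - by rewrite lee_fin mulr_ge0 ?powR_ge0// ltW.
  rewrite [RHS]integral_mkcond; apply: eq_integral => x _.
  by rewrite patchE mem_setE in_itv/= andbT /f /= y0.
rewrite /eGamma [LHS]integral_mkcond; apply: eq_integral => x _.
rewrite patchE mem_setE in_itv/= andbT; case: ifPn => [x0|]; last first.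
  rewrite -leNgt => x0; apply/esym; apply: integral0_eq => y _; rewrite /f /=.
  case: ifPn => // /andP[y0 yx].
  by have := lt_le_trans (lt_trans y0 yx) x0; rewrite ltxx.
rewrite /gamma_fun addrK EFinM -integral_powR// muleC -ge0_integralZl//=; last 2 first.
- apply/measurable_EFinP; apply: measurable_funTS; apply: measurable_funM => //.
- by move=> y _; rewrite lee_fin mulr_ge0 ?powR_ge0// ltW.
rewrite [LHS]integral_mkcond; apply: eq_integral => y _.
rewrite patchE mem_setE in_itv/= /f /=; case: ifPn => // _.
by rewrite -EFinM mulrC.
Qed.

Lemma eGamma1 : eGamma 1 = 1%E.
Proof.
rewrite /eGamma; under eq_integral.
  move=> x _; rewrite /gamma_fun subrr powRr0 mul1r; over.
by rewrite integral_expR_tail oppr0 expR0.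
Qed.

Lemma eGamma_nat n : eGamma n.+1%:R = (n`!)%:R%:E.
Proof.
elim: n => [|n IHn]; first by rewrite eGamma1 fact0.
by rewrite -addn1 natrD eGammaS ?ltr0n// IHn -EFinM -natrM factS.
Qed.

(** For t >= 1 the integrand lies below the sum of those at 1 and at a large
    integer; for s in (0,1) finiteness descends from s + 1. *)
Lemma eGamma_lty s : 0 < s -> (eGamma s < +oo)%E.
Proof.
have large t : 1 <= t -> (eGamma t < +oo)%E.
  move=> t1; pose n := Num.truncn (t - 1).
  have nt : t - 1 < n.+1%:R by exact: truncnS_gt.
  apply: (@le_lt_trans _ _ (eGamma 1 + eGamma n.+2%:R)%E); last first.
    by rewrite eGamma1 eGamma_nat -EFinD ltry.
  rewrite /eGamma -ge0_integralD//=; last 4 first.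
  - by move=> x _; rewrite lee_fin gamma_fun_ge0.
  - by apply/measurable_EFinP; apply: measurable_funTS; exact: measurable_gamma_fun.
  - by move=> x _; rewrite lee_fin gamma_fun_ge0.
  - by apply/measurable_EFinP; apply: measurable_funTS; exact: measurable_gamma_fun.
  apply: ge0_le_integral => //=.
  - by move=> x _; rewrite lee_fin gamma_fun_ge0.
  - by apply/measurable_EFinP; apply: measurable_funTS; exact: measurable_gamma_fun.
  - apply/measurable_EFinP; apply: measurable_funTS.
    by apply: measurable_funD; exact: measurable_gamma_fun.
  move=> x; rewrite in_itv/= andbT => x0; rewrite -EFinD lee_fin /gamma_fun.
  rewrite -mulrDl ler_pM2r ?expR_gt0// subrr powRr0 -[n.+2]addn1 natrD addrK.
  have [x1|x1] := leP x 1.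
    apply: (@le_trans _ _ 1); last by rewrite lerDl powR_ge0.
    rewrite -[leRHS](powRr0 x); apply: ger_powR; last by rewrite subr_ge0.
    by rewrite x0.
  apply: (@le_trans _ _ (x `^ n.+1%:R)); last by rewrite lerDr.
  by apply: ler_powR; rewrite ltW.
move=> s0; have := large (s + 1); rewrite lerDr => /(_ (ltW s0)).
rewrite eGammaS// => h; rewrite ltNge leye_eq; apply/negP => /eqP soo.
by move: h; rewrite soo mulry gtr0_sg// mul1e ltxx.
Qed.

Lemma eGammaK s : 0 < s -> eGamma s = (Gamma s)%:E.
Proof.
by move=> s0; rewrite GammaE fineK// ge0_fin_numE ?eGamma_ge0// eGamma_lty.
Qed.

Lemma integrable_gamma_fun s : 0 < s ->
  mu.-integrable `]0%R, +oo[ (EFin \o gamma_fun s).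
Proof.
move=> s0; apply/integrableP; split.
  by apply/measurable_EFinP; apply: measurable_funTS; exact: measurable_gamma_fun.
under eq_integral do rewrite gee0_abs ?lee_fin ?gamma_fun_ge0//.
exact: eGamma_lty.
Qed.

Lemma GammaS s : 0 < s -> Gamma (s + 1) = s * Gamma s.
Proof.
move=> s0; apply: EFin_inj.
by rewrite -eGammaK ?addr_gt0// eGammaS// eGammaK.
Qed.

Lemma Gamma_nat n : Gamma n.+1%:R = (n`!)%:R :> R.
Proof. by apply: EFin_inj; rewrite -eGammaK ?ltr0n// eGamma_nat. Qed.

Lemma Gamma_ge0 s : 0 <= Gamma s.
Proof. by rewrite GammaE fine_ge0// eGamma_ge0. Qed.

End gamma.

(** * Growth of the Gamma function *)

Section gamma_asymptotics.
Context {R : realType}.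
Notation mu := (@lebesgue_measure R).
Implicit Types s x y : R.

(** The tangent line of the concave function y |-> y^s at 1, obtained from the
    inequality 1 + u <= exp u at u = ln y - ln m and at u = - ln m. *)
Lemma powR_bernoulli y s : 0 < y -> 0 < s < 1 -> y `^ s <= 1 - s + s * y.
Proof.
move=> y0 /andP[s0 s1].
set m := 1 - s + s * y.
have m0 : 0 < m by rewrite addr_gt0 ?subr_gt0 ?mulr_gt0.
rewrite /powR gt_eqF// -[leRHS](lnK m0) ler_expR.
have h1 := expR_ge1Dx (ln y - ln m); have h2 := expR_ge1Dx (- ln m).
rewrite expRB !lnK// in h1; rewrite expRN lnK// in h2.
have : s * (y / m) + (1 - s) * m^-1 = 1.
  by rewrite /m; field; rewrite -/m gt_eqF.
nra.
Qed.

(** Integrates Bernoulli's inequality for (x / l)^s against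
    x^(p-1) exp(-x). The free parameter l is chosen by each use. *)
Lemma Gamma_interpolation p s l : 0 < p -> 0 < s < 1 -> 0 < l ->
  Gamma (p + s) <= l `^ s * ((1 - s) * Gamma p + s / l * Gamma (p + 1)).
Proof.
move=> p0 s01 l0; have /andP[s0 s1] := s01.
rewrite /Gamma.
have i1 := integrable_gamma_fun p0.
have i2 : mu.-integrable `]0%R, +oo[ (EFin \o gamma_fun (p + 1)).
  by apply: integrable_gamma_fun; rewrite addr_gt0.
have i3 : mu.-integrable `]0%R, +oo[ (EFin \o gamma_fun (p + s)).
  by apply: integrable_gamma_fun; rewrite addr_gt0.
have i1' : mu.-integrable `]0%R, +oo[ (EFin \o (fun x => (1 - s) * gamma_fun p x)).
  exact: integrable_scale.
have i2' : mu.-integrable `]0%R, +oo[ (EFin \o (fun x => s / l * gamma_fun (p + 1) x)).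
  exact: integrable_scale.
rewrite -!RintegralZl// -RintegralD// -RintegralZl//; last first.
  exact: integrable_add.
apply: le_Rintegral => //.
  apply: integrable_scale => //.
  exact: integrable_add.
move=> x; rewrite /= in_itv/= andbT => x0; rewrite /gamma_fun.
rewrite !mulrA -mulrDl mulrA ler_pM2r ?expR_gt0//.
have xn : x != 0 by rewrite gt_eqF.
have -> : p + s - 1 = p - 1 + s by ring.
rewrite (@powRD _ x (p - 1) s) ?xn ?implybT// addrK.
have -> : x `^ p = x * x `^ (p - 1) by rewrite mulr_powRB1// ltW.
have -> : l `^ s * ((1 - s) * x `^ (p - 1) + s / l * (x * x `^ (p - 1))) =
  x `^ (p - 1) * (l `^ s * (1 - s + s * (x / l))) by ring.
rewrite ler_pM2l ?powR_gt0//.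
rewrite -ler_pdivrMl ?powR_gt0// mulrC -powRN.
have -> : x `^ s * l `^ (- s) = (x / l) `^ s.
  by rewrite powRM ?invr_ge0 ?ltW// -(powR_inv1 (ltW l0)) -powRrM mulN1r.
by apply: powR_bernoulli => //; rewrite divr_gt0.
Qed.

(** The integrand of l Gamma(p+s) + Gamma(p-s) / l dominates twice that of
    Gamma(p), by AM-GM for l x^s and its inverse; taking
    l = Gamma(p) / Gamma(p+s) gives the claim. *)
Lemma Gamma_midpoint_log_convex p s : 0 < s < p ->
  Gamma p ^+ 2 <= Gamma (p + s) * Gamma (p - s).
Proof.
move=> /andP[s0 sp].
have key l : 0 < l -> 2 * Gamma p <= l * Gamma (p + s) + l^-1 * Gamma (p - s).
  move=> l0; rewrite /Gamma.
  have i1 : mu.-integrable `]0%R, +oo[ (EFin \o gamma_fun p).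
    by apply: integrable_gamma_fun; lra.
  have i2 : mu.-integrable `]0%R, +oo[ (EFin \o gamma_fun (p + s)).
    by apply: integrable_gamma_fun; lra.
  have i3 : mu.-integrable `]0%R, +oo[ (EFin \o gamma_fun (p - s)).
    by apply: integrable_gamma_fun; lra.
  have i2' : mu.-integrable `]0%R, +oo[ (EFin \o (fun x => l * gamma_fun (p + s) x)).
    exact: integrable_scale.
  have i3' : mu.-integrable `]0%R, +oo[ (EFin \o (fun x => l^-1 * gamma_fun (p - s) x)).
    exact: integrable_scale.
  rewrite -!RintegralZl// -RintegralD//.
  apply: le_Rintegral => //.
    exact: integrable_scale.
    exact: integrable_add.
  move=> x; rewrite /= in_itv/= andbT => x0; rewrite /gamma_fun.
  rewrite !mulrA -mulrDl ler_pM2r ?expR_gt0//.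
  have xn : x != 0 by rewrite gt_eqF.
  have -> : p + s - 1 = p - 1 + s by ring.
  have -> : p - s - 1 = p - 1 - s by ring.
  rewrite (@powRD _ x (p - 1) s) ?(@powRD _ x (p - 1) (- s)) ?xn ?implybT// powRN.
  set P := x `^ (p - 1); set Q := x `^ s.
  have P0 : 0 < P by rewrite powR_gt0.
  have Q0 : 0 < Q by rewrite powR_gt0.
  have -> : l * (P * Q) + l^-1 * (P / Q) = P * (l * Q + (l * Q)^-1).
    by field; rewrite !gt_eqF.
  rewrite mulrC ler_pM2l//.
  have lQ : 0 < l * Q by rewrite mulr_gt0.
  rewrite -subr_ge0.
  have -> : l * Q + (l * Q)^-1 - 2 = (l * Q - 1) ^+ 2 / (l * Q).
    by field; rewrite !gt_eqF.
  by rewrite divr_ge0 ?sqr_ge0 ?ltW.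
have := Gamma_ge0 (R := R); set A := Gamma (p + s); set B := Gamma (p - s).
set C := Gamma p => G0.
have A0 : 0 <= A := G0 _; have B0 : 0 <= B := G0 _.
have [C0|C0] := eqVneq C 0; first by rewrite C0 expr0n/= mulr_ge0.
have {}C0 : 0 < C by rewrite lt_neqAle eq_sym C0 G0.
have [A00|A00] := eqVneq A 0.
  (* Were A zero, a large l would violate the inequality. *)
  have l0 : 0 < B / C + 1 by rewrite ltr_wpDl// divr_ge0// ltW.
  have := key _ l0; rewrite -/A -/B A00 mulr0 add0r [leRHS]mulrC ler_pdivlMr//.
  have -> : 2 * C * (B / C + 1) = 2 * B + 2 * C by field; rewrite gt_eqF.
  lra.
have {}A0 : 0 < A by rewrite lt_neqAle eq_sym A00.
have := key _ (divr_gt0 C0 A0); rewrite -/A -/B -/C.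
have -> : C / A * A + (C / A)^-1 * B = C + A * B / C by field; rewrite !gt_eqF.
have -> : 2 * C = C + C ^+ 2 / C by field; rewrite gt_eqF.
by rewrite lerD2l ler_pM2r ?invr_gt0.
Qed.

(** By the functional equation this is Gamma(1+s) Gamma(1-s) times the
    product of the 1 - s^2 / k^2 for 1 <= k <= n. *)
Definition gamma_ratio s (n : nat) : R :=
  Gamma (n.+1%:R + s) * Gamma (n.+1%:R - s) / n`!%:R ^+ 2.

Lemma gamma_ratio_bounds s n : 0 < s < 1 ->
  1 <= gamma_ratio s n.+1 <= 1 + s / n.+1%:R.
Proof.
move=> s01; have /andP[s0 s1] := s01.
have f0 : 0 < n.+1`!%:R :> R by rewrite ltr0n fact_gt0.
rewrite /gamma_ratio ler_pdivlMr ?exprn_gt0// mul1r ler_pdivrMr ?exprn_gt0//.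
rewrite -Gamma_nat; apply/andP; split.
  apply: Gamma_midpoint_log_convex; rewrite s0/=.
  by apply: (lt_le_trans s1); rewrite ler1n.
have n0 : 0 < n.+1%:R :> R by rewrite ltr0n.
have A1 : Gamma (n.+2%:R + s) <= n.+1%:R `^ s * (Gamma n.+2%:R * (1 + s / n.+1%:R)).
  apply: le_trans (Gamma_interpolation _ s01 n0) _; first by rewrite ltr0n.
  rewrite GammaS ?ltr0n//; rewrite ler_pM2l ?powR_gt0//.
  set G := Gamma _; rewrite le_eqVlt; apply/orP; left; apply/eqP.
  have -> : n.+2%:R = n.+1%:R + 1 :> R by rewrite natr1.
  by field; rewrite gt_eqF.
have B1 : Gamma (n.+2%:R - s) <= n.+1%:R `^ (- s) * Gamma n.+2%:R.
  have -> : n.+2%:R - s = n.+1%:R + (1 - s) by rewrite -natr1; ring.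
  have s01' : 0 < 1 - s < 1 by apply/andP; split; lra.
  apply: le_trans (Gamma_interpolation n0 s01' n0) _.
  have -> : n.+2%:R = n.+1%:R + 1 :> R by rewrite natr1.
  rewrite GammaS//.
  rewrite (@powRD _ _ 1 (- s)) ?pnatr_eq0 ?implybT// powRr1 ?(ltW n0)//.
  rewrite le_eqVlt; apply/orP; left; apply/eqP.
  by field; rewrite gt_eqF.
apply: (le_trans (ler_pM (Gamma_ge0 _) (Gamma_ge0 _) A1 B1)).
rewrite powRN le_eqVlt; apply/orP; left; apply/eqP.
by field; rewrite !gt_eqF ?powR_gt0.
Qed.

Lemma gamma_ratioS s n : 0 < s < 1 ->
  gamma_ratio s n.+1 = (1 - s ^+ 2 / n.+1%:R ^+ 2) * gamma_ratio s n.
Proof.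
move=> /andP[s0 s1]; rewrite /gamma_ratio.
have n1 : 1 <= n.+1%:R :> R by rewrite ler1n.
have -> : n.+2%:R = n.+1%:R + 1 :> R by rewrite natr1.
have -> : n.+1%:R + 1 + s = n.+1%:R + s + 1 :> R by ring.
have -> : n.+1%:R + 1 - s = n.+1%:R - s + 1 :> R by ring.
rewrite !GammaS; [|lra..].
rewrite factS natrM.
field; rewrite pnatr_eq0 -lt0n fact_gt0/=.
rewrite gt_eqF//; lra.
Qed.

Lemma cvg_gamma_ratio s : 0 < s < 1 -> gamma_ratio s n @[n --> \oo] --> (1 : R).
Proof.
move=> s01.
rewrite -(cvg_shiftn 1); under eq_fun do rewrite addn1.
apply: (@squeeze_cvgr _ _ _ _ (cst 1) (fun n => 1 + s / n.+1%:R)).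
- by near=> n; rewrite gamma_ratio_bounds.
- exact: cvg_cst.
- rewrite -[X in _ --> X]addr0; apply: cvgD; first exact: cvg_cst.
  rewrite -[X in _ --> X](mulr0 s); apply: cvgM; first exact: cvg_cst.
  exact: cvg_harmonic.
Unshelve. all: by end_near. Qed.

End gamma_asymptotics.

(** * Cosine moments and the reflection formula *)

Global Instance is_derive_exp_fun (R : realType) (f : R -> R) n (x df : R) :
  is_derive x 1 f df ->
  is_derive x 1 (fun y => f y ^+ n) (n%:R * f x ^+ n.-1 * df).
Proof.
move=> dfx; rewrite (_ : (fun y => _) = f ^+ n); first exact: is_deriveX.
by apply/funext => y; elim: n => [|n IHn]; rewrite ?expr0// !exprS IHn.
Qed.

Section cosine_moments.
Context {R : realType}.
Notation mu := (@lebesgue_measure R).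
Implicit Types s x y : R.

Definition cos_moment s n : R :=
  \int[mu]_(x in `[0, pi / 2]) (cos (2 * s * x) * cos x ^+ n).

Let pihalf_gt0 : 0 < pi / 2 :> R.
Proof. by rewrite divr_gt0 ?pi_gt0. Qed.

Let ccos s : continuous (fun x : R => cos (2 * s * x)).
Proof. by move=> x; exact: is_derive_cvg. Qed.

Let ccosn n : continuous (fun x : R => cos x ^+ n).
Proof.
move=> x; apply: (@continuous_comp _ _ _ cos (fun y => y ^+ n)).
  exact: continuous_cos.
exact: exprn_continuous.
Qed.

Let ctrig s n : continuous (fun x : R => cos (2 * s * x) * cos x ^+ n).
Proof. by move=> x; apply: cvgM; [exact: ccos|exact: ccosn]. Qed.

Let integrable_cts (f : R -> R) (a b : R) : continuous f ->
  mu.-integrable `[a, b] (EFin \o f).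
Proof.
move=> cf; apply: continuous_compact_integrable; first exact: segment_compact.
exact: continuous_subspaceT.
Qed.

Let FTC_cts (f F : R -> R) a b : a < b -> continuous f ->
  (forall x, is_derive x 1 F (f x)) ->
  \int[mu]_(x in `[a, b]) f x = F b - F a.
Proof.
move=> ab cf dF; rewrite /Rintegral (@continuous_FTC2 _ f F)//.
- exact: continuous_subspaceT.
- have cF x : F y @[y --> x] --> F x by exact: is_derive_cvg.
  split => //.
  + exact: cvg_at_right_filter.
  + exact: cvg_at_left_filter.
- by move=> x _; rewrite derive1E; case: (dF x).
Qed.

Lemma cos_moment0 s : s != 0 -> cos_moment s 0 = sin (pi * s) / (2 * s).
Proof.
move=> s0; rewrite /cos_moment.
apply: etrans.
  apply: (@FTC_cts _ (fun x => sin (2 * s * x) / (2 * s))) ; [exact: pihalf_gt0|exact: ctrig|].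
  move=> x; apply: is_derive_eq; rewrite expr0 mulr1 /GRing.scale /=.
  by field; exact: s0.
rewrite /= mulr0 sin0 mul0r subr0 (_ : 2 * s * (pi / 2) = pi * s)//; by field.
Qed.

Lemma cos_moment00 : cos_moment 0 0 = pi / 2.
Proof.
rewrite /cos_moment; apply: etrans.
  apply: (@FTC_cts _ id) ; [exact: pihalf_gt0|exact: ctrig|].
  by move=> x; apply: is_derive_eq; rewrite expr0 mulr1 mulr0 mul0r cos0.
by rewrite subr0.
Qed.

(** The difference of the two sides is the integral of the derivative of
    (n+2) cos(2 s x) cos(x)^(n+1) sin(x) - 2 s sin(2 s x) cos(x)^(n+2), a
    function that vanishes at 0 and at pi / 2. *)
Lemma cos_moment_rec s n :
  (n.+2%:R ^+ 2 - 4 * s ^+ 2) * cos_moment s n.+2 =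
  n.+2%:R * n.+1%:R * cos_moment s n.
Proof.
apply/eqP; rewrite -subr_eq0; apply/eqP; rewrite /cos_moment.
have i1 m : mu.-integrable `[0, pi / 2]
    (EFin \o (fun x => cos (2 * s * x) * cos x ^+ m)).
  exact/integrable_cts/ctrig.
have ct m (k : R) : continuous (fun x : R => k * (cos (2 * s * x) * cos x ^+ m)).
  by move=> x; apply: cvgM; [exact: cvg_cst|exact: ctrig].
rewrite -!RintegralZl//.
rewrite -RintegralB//; [|exact: integrable_scale..].
apply: etrans.
  apply: (@FTC_cts _ (fun x => n.+2%:R * (cos (2 * s * x) * cos x ^+ n.+1 * sin x) -
   2 * s * (sin (2 * s * x) * cos x ^+ n.+2))).
  - exact: pihalf_gt0.
  - by move=> x; apply: cvgB; exact: ct.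
  - move=> x; apply: is_derive_eq; rewrite /GRing.scale /=.
    have -> : n.+2%:R = n.+1%:R + 1 :> R by rewrite natr1.
    rewrite !exprS.
    have h : sin x * sin x = 1 - cos x ^+ 2 by rewrite -expr2 sin2cos2.
    set S := sin x in h *; set C := cos x in h *.
    set m : R := n.+1%:R; set P := C ^+ n.
    set S2 := sin (2 * s * x); set C2 := cos (2 * s * x).
    transitivity ((m + 1) * C2 * C ^+ 2 * P - (m + 1) * m * C2 * P * (S * S)
      - 4 * s ^+ 2 * C2 * C ^+ 2 * P); first by ring.
    by rewrite h; ring.
by rewrite /= cos_pihalf !expr0n/= !mulr0 sin0; ring.
Qed.

Let mono0 (F f : R -> R) x : (forall y, is_derive y 1 F (f y)) ->
  (forall y, 0 < y < x -> 0 <= f y) -> 0 <= x -> F 0 <= F x.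
Proof.
move=> dF f0; rewrite le_eqVlt => /predU1P[<-//|x0].
have [|y] := @MVT _ F f 0 x x0 (fun y _ => dF y).
  by apply: continuous_subspaceT => y; exact: is_derive_cvg.
rewrite in_itv/= => /f0 fy; rewrite subr0 => h.
by rewrite -subr_ge0 h mulr_ge0// ltW.
Qed.

Lemma sin_le_id x : 0 <= x -> sin x <= x.
Proof.
move=> x0; rewrite -subr_ge0.
have := @mono0 (fun y => y - sin y) (fun y => 1 - cos y) x.
rewrite sin0 subr0; apply => //.
Qed.

Lemma cos_ge_quadratic x : 0 <= x -> 1 - x ^+ 2 / 2 <= cos x.
Proof.
move=> x0; rewrite -subr_ge0.
have := @mono0 (fun y => cos y - (1 - y ^+ 2 / 2)) (fun y => y - sin y) x.
rewrite cos0 expr0n/= mul0r subr0 subrr; apply => //.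
- by move=> y; apply: is_derive_eq; rewrite /GRing.scale/=; field.
- by move=> y /andP[/ltW y0 _]; rewrite subr_ge0 sin_le_id.
Qed.

Lemma mul_cos_le_sin x : 0 <= x <= pi / 2 -> x * cos x <= sin x.
Proof.
move=> /andP[x0 xpi]; rewrite -subr_ge0.
have := @mono0 (fun y => sin y - y * cos y) (fun y => y * sin y) x.
rewrite sin0 mul0r subrr; apply => //.
- move=> y; apply: is_derive_eq; rewrite /GRing.scale/=; ring.
- move=> y /andP[y0 yx]; rewrite mulr_ge0 ?(ltW y0)// sin_ge0_pi// ltW//=.
  by have := pi_gt0 R; lra.
Qed.

(** Pointwise 1 - cos(2 s x) <= 2 s^2 x^2, and (x cos x)^2 <= 1 - cos(x)^2, so
    the loss is at most 2 s^2 times the difference of the moments n and n + 2 at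
    s = 0; by [cos_moment_rec] this difference is the moment n + 2 divided by
    n + 1. *)
Lemma cos_moment_bounds s n : 0 <= s ->
  (1 - 2 * s ^+ 2 / n.+1%:R) * cos_moment 0 n.+2 <= cos_moment s n.+2 <=
  cos_moment 0 n.+2.
Proof.
move=> s0.
have i1 t m : mu.-integrable `[0, pi / 2]
    (EFin \o (fun x => cos (2 * t * x) * cos x ^+ m)).
  exact/integrable_cts/ctrig.
have cospos x : `[0, pi / 2]%classic x -> 0 <= cos x.
  rewrite /= in_itv/= => /andP[x0 x1]; apply: cos_ge0_pihalf; rewrite x1 andbT.
  by apply: le_trans x0; rewrite oppr_le0 ltW.
apply/andP; split; last first.
  apply: le_Rintegral => // x /cospos cx.
  by rewrite ler_wpM2r ?exprn_ge0// mulr0 mul0r cos0 cos_le1.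
have -> : (1 - 2 * s ^+ 2 / n.+1%:R) * cos_moment 0 n.+2 =
  (1 + 2 * s ^+ 2) * cos_moment 0 n.+2 - 2 * s ^+ 2 * cos_moment 0 n.
  have := cos_moment_rec 0 n; rewrite expr0n/= mulr0 subr0.
  have -> : n.+2%:R = n.+1%:R + 1 :> R by rewrite natr1.
  have m0 : 0 < n.+1%:R :> R by rewrite ltr0n.
  set m : R := n.+1%:R in m0 *; set D := cos_moment _ _; set D' := cos_moment _ _.
  rewrite expr2 -!mulrA => /(mulfI _) h.
  have -> : D' = (m + 1) * D / m.
    rewrite h ?mulrK ?unitfE ?gt_eqF//; last by rewrite addr_gt0.
    by field; rewrite gt_eqF.
  by field; rewrite gt_eqF.
rewrite /cos_moment -!RintegralZl// -RintegralB//; [|exact: integrable_scale..].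
apply: le_Rintegral => //.
  rewrite (_ : EFin \o _ = EFin \o (fun x =>
      (1 + 2 * s ^+ 2) * (cos (2 * 0 * x) * cos x ^+ n.+2) +
      (- (2 * s ^+ 2)) * (cos (2 * 0 * x) * cos x ^+ n))).
    by apply: integrable_add => //; exact: integrable_scale.
  by apply/funext => x /=; rewrite mulNr.
move=> x x01; have cx := cospos _ x01; move: x01.
rewrite /= in_itv/= => /andP[x0 x1].
rewrite mulr0 mul0r cos0 !mul1r.
have h1 : 1 - 2 * s ^+ 2 * x ^+ 2 <= cos (2 * s * x).
  have := @cos_ge_quadratic (2 * s * x).
  rewrite !mulr_ge0// => /(_ isT); apply: le_trans.
  by rewrite le_eqVlt; apply/orP; left; apply/eqP; field.
have h2 : (x * cos x) ^+ 2 <= 1 - cos x ^+ 2.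
  rewrite -sin2cos2 lerXn2r ?nnegrE ?mulr_ge0//.
    by apply: sin_ge0_pi; rewrite x0/=; have := pi_gt0 R; lra.
  by apply: mul_cos_le_sin; rewrite x0.
have cn : 0 <= cos x ^+ n by rewrite exprn_ge0.
apply: (@le_trans _ _ ((1 - 2 * s ^+ 2 * x ^+ 2) * cos x ^+ n.+2)); last first.
  by rewrite ler_wpM2r// exprn_ge0.
rewrite !exprS !expr0 !mulr1.
set P := cos x ^+ n in cn *; set C := cos x in h2 cx *.
rewrite -subr_ge0.
have -> : (1 - 2 * (s * s) * (x * x)) * (C * (C * P)) -
   ((1 + 2 * (s * s)) * (C * (C * P)) - 2 * (s * s) * P) =
   2 * s ^+ 2 * P * (1 - C ^+ 2 - (x * C) ^+ 2) by ring.
by rewrite !mulr_ge0 ?sqr_ge0// subr_ge0.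
Qed.

Lemma cos_moment0_gt0 k : 0 < cos_moment 0 k.*2.
Proof.
elim: k => [|k IHk]; first by rewrite cos_moment00.
have := cos_moment_rec 0 k.*2; rewrite expr0n/= mulr0 subr0 => h.
rewrite doubleS -(@pmulr_rgt0 _ (k.*2.+2%:R ^+ 2)) ?exprn_gt0 ?ltr0n// h.
by rewrite !mulr_gt0 ?ltr0n.
Qed.

(** By [cos_ratioS], sin(pi s) / (pi s) is this ratio times the product of the
    1 - s^2 / j^2 for 1 <= j <= k. *)
Definition cos_ratio s k : R := cos_moment s k.*2 / cos_moment 0 k.*2.

Lemma cos_ratio0 s : s != 0 -> cos_ratio s 0 = sin (pi * s) / (pi * s).
Proof.
move=> s0; rewrite /cos_ratio cos_moment0// cos_moment00.
have := gt_eqF (pi_gt0 R); move: (pi : R) => p p0.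
by field; rewrite s0 p0.
Qed.

Lemma cos_ratioS s k :
  cos_ratio s k = (1 - s ^+ 2 / k.+1%:R ^+ 2) * cos_ratio s k.+1.
Proof.
rewrite /cos_ratio doubleS.
have h := cos_moment_rec s k.*2; have h0 := cos_moment_rec 0 k.*2.
have d0 := cos_moment0_gt0 k; have d1 := cos_moment0_gt0 k.+1.
rewrite doubleS in d1.
move: h h0; rewrite expr0n/= mulr0 subr0.
have -> : k.*2.+2%:R = 2 * k.+1%:R :> R by rewrite -doubleS -mul2n natrM.
set m : R := k.+1%:R; set p : R := k.*2.+1%:R => h h0.
have m0 : 0 < m by rewrite ltr0n.
have p0 : 0 < p by rewrite ltr0n.
have tmp0 : 2 * m * p != 0 by rewrite !mulf_neq0 ?gt_eqF.
have -> : cos_moment s k.*2 =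
    ((2 * m) ^+ 2 - 4 * s ^+ 2) * cos_moment s k.*2.+2 / (2 * m * p).
  by rewrite h [X in _ = X / _]mulrC mulfK.
have -> : cos_moment 0 k.*2 = (2 * m) ^+ 2 * cos_moment 0 k.*2.+2 / (2 * m * p).
  by rewrite h0 [X in _ = X / _]mulrC mulfK.
by field; rewrite !gt_eqF.
Qed.

Lemma cvg_cos_ratio s : 0 <= s -> cos_ratio s n @[n --> \oo] --> (1 : R).
Proof.
move=> s0; rewrite -(cvg_shiftn 1); under eq_fun do rewrite addn1.
apply: (@squeeze_cvgr _ _ _ _ (fun n => 1 - 2 * s ^+ 2 / n.+1%:R) (cst 1)).
- near=> n; rewrite /= /cos_ratio doubleS.
  have d0 := cos_moment0_gt0 n.+1; rewrite doubleS in d0.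
  rewrite ler_pdivlMr// ler_pdivrMr// mul1r.
  have /andP[h1 ->] := cos_moment_bounds n.*2 s0; rewrite andbT.
  apply: le_trans h1; rewrite ler_pM2r// lerD2l lerN2.
  rewrite ler_wpM2l ?mulr_ge0 ?sqr_ge0// lef_pV2 ?posrE ?ltr0n//.
  by rewrite ler_nat ltnS -addnn leq_addr.
- rewrite -[X in _ --> X]subr0; apply: cvgB; first exact: cvg_cst.
  rewrite -[X in _ --> X](mulr0 (2 * s ^+ 2)); apply: cvgM; first exact: cvg_cst.
  exact: cvg_harmonic.
- exact: cvg_cst.
Unshelve. all: by end_near. Qed.

End cosine_moments.

(** [gamma_ratio] picks up at each step the factor that [cos_ratio] loses, so
    their product does not depend on n; it tends to 1, and at n = 0 it is
    sin(pi s) Gamma(s) Gamma(1-s) / pi. *)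
Theorem Gamma_reflection (R : realType) (s : R) : 0 < s < 1 ->
  sin (pi * s) * Gamma s * Gamma (1 - s) = pi.
Proof.
move=> s01; have /andP[s0 s1] := s01.
have inv n : gamma_ratio s n * cos_ratio s n = gamma_ratio s 0 * cos_ratio s 0.
  elim: n => // n <-.
  by rewrite gamma_ratioS// [in RHS]cos_ratioS; ring.
have cvg1 : gamma_ratio s n * cos_ratio s n @[n --> \oo] --> (1 : R).
  rewrite -[X in _ --> X](mulr1 1); apply: cvgM; first exact: cvg_gamma_ratio.
  by apply: cvg_cos_ratio; exact: ltW.
have : gamma_ratio s 0 * cos_ratio s 0 = 1.
  rewrite -(cvg_lim _ cvg1)//; under eq_fun do rewrite inv.
  by rewrite lim_cst.
rewrite /gamma_ratio cos_ratio0 ?gt_eqF// fact0 expr1n divr1.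
have -> : 1 + s = s + 1 by ring.
rewrite GammaS// => h.
have pi0 : pi != 0 :> R by rewrite gt_eqF ?pi_gt0.
have sn0 : s != 0 by rewrite gt_eqF.
move: h; set S := sin _; move: (pi : R) pi0 @S => p p0 S.
rewrite mulrA => /divr1_eq h.
by apply: (mulfI sn0); rewrite [RHS]mulrC -h; ring.
Qed.

(** * Iterated integrals and affine changes of variables *)

Section affine1.
Context {R : realType}.
Notation mu := (@lebesgue_measure R).
Implicit Types c t : R.
Local Notation RM := (measurableTypeR R).

Let mfaff c t : measurable_fun setT (fun x : RM => c + t * x : RM).
Proof. by apply: measurable_funD => //; apply: measurable_funM. Qed.

(** Both sides define measures that agree on half-open intervals. *)
Lemma ge0_integral_affine c t (H : RM -> \bar R) : 0 < t ->
  measurable_fun setT H -> (forall x, 0 <= H x)%E ->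
  (\int[mu]_x H x = t%:E * \int[mu]_x H (c + t * x)%R)%E.
Proof.
move=> t0 mH H0.
pose phi (x : RM) : RM := c + t * x.
have mphi : measurable_fun setT phi by exact: mfaff.
pose p : {measure set RM -> \bar R} :=
  measure_function_pushforward__canonical__measure_function_Measure mu mphi.
pose m : {measure set RM -> \bar R} := mscale (NngNum (ltW t0)) p.
transitivity (\int[m]_x H x)%E.
  apply: eq_measure_integral => A mA _.
  apply: lebesgue_measure_unique => // X [[a b] _ <-] /=.
  rewrite /mscale /= /pushforward.
  have -> : phi @^-1` `]a, b] = `](a - c) / t, (b - c) / t]%classic.
    apply/seteqP; split => x; rewrite /phi /= !in_itv /=.
      by rewrite ltr_pdivrMr// ler_pdivlMr// => /andP[h1 h2]; apply/andP; split; lra.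
    by rewrite ltr_pdivrMr// ler_pdivlMr// => /andP[h1 h2]; apply/andP; split; lra.
  rewrite !lebesgue_measure_itv/= !lte_fin ltr_pM2r ?invr_gt0// ltrD2r.
  case: ifPn => _; last by rewrite mule0.
  by rewrite -!EFinD -EFinM; congr EFin; field; rewrite gt_eqF.
rewrite ge0_integral_mscale//=; congr (_ * _)%E.
by rewrite ge0_integral_pushforward.
Qed.

End affine1.

Section lebesgue_tuple_integrals.
Context {R : realType}.
Notation mu := (@lebesgue_measure R).
Local Notation RM := (measurableTypeR R).
Local Open Scope ereal_scope.

Lemma ge0_integral_tuple0 (f : 0.-tuple R -> \bar R) :
  measurable_fun setT f -> \int[lebesgue_tuple 0]_y f y = f [tuple].
Proof. by move=> mf; rewrite /= integral_dirac// diracT mul1e. Qed.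

Lemma ge0_integral_tupleS n (f : n.+1.-tuple R -> \bar R) :
  measurable_fun setT f -> (forall y, 0 <= f y) ->
  \int[lebesgue_tuple n.+1]_y f y =
  \int[mu]_x \int[lebesgue_tuple n]_y f (pair_cons (x, y)).
Proof.
move=> mf f0.
have := @ge0_integral_pushforward _ _ _ _ R _ (@measurable_pair_cons R n)
  (mu \x lebesgue_tuple n) setT f measurableT mf (fun y _ => f0 y).
have mp := measurableT_comp mf (@measurable_pair_cons R n).
rewrite preimage_setT (fubini_tonelli1 _ mp (fun z => f0 _)) => <-.
by apply: eq_measure_integral; first exact: measurable_pair_cons.
Qed.

Lemma measurable_slice n (f : n.+1.-tuple R -> \bar R) (x : RM) :
  measurable_fun setT f -> measurable_fun setT (fun y => f (pair_cons (x, y))).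
Proof.
move=> mf.
have mp := measurableT_comp mf (@measurable_pair_cons R n).
exact: measurableT_comp mp (pair1_measurable x).
Qed.

Lemma measurable_slice_integral n (f : n.+1.-tuple R -> \bar R) :
  measurable_fun setT f -> (forall y, 0 <= f y) ->
  measurable_fun setT
    (fun x : RM => \int[lebesgue_tuple n]_y f (pair_cons (x, y))).
Proof.
move=> mf f0.
have mp := measurableT_comp mf (@measurable_pair_cons R n).
exact: (@measurable_fun_fubini_tonelli_F _ _ _ _ R (lebesgue_tuple n) _ mp (fun p => f0 _)).
Qed.

Lemma integrable_pair_cons n (f : n.+1.-tuple R -> \bar R) :
  (lebesgue_tuple n.+1).-integrable setT f ->
  (mu \x lebesgue_tuple n).-integrable setT (f \o @pair_cons R n).
Proof.
move=> /integrableP[mf foo]; apply/integrableP; split.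
  exact: measurableT_comp mf (@measurable_pair_cons R n).
have maf : measurable_fun setT (abse \o f) by exact: measurableT_comp.
rewrite (ge0_integral_tupleS maf) in foo; last by move=> y; exact: abse_ge0.
rewrite fubini_tonelli1//.
by apply: measurableT_comp => //; exact: measurableT_comp (@measurable_pair_cons R n).
Qed.

Lemma integral_tupleS n (f : n.+1.-tuple R -> \bar R) :
  (lebesgue_tuple n.+1).-integrable setT f ->
  \int[lebesgue_tuple n.+1]_y f y =
  \int[mu \x lebesgue_tuple n]_p f (pair_cons p).
Proof.
move=> intf; have intp := integrable_pair_cons intf.
have := @integral_pushforward _ _ _ _ R _ (@measurable_pair_cons R n)
  (mu \x lebesgue_tuple n) setT f (measurable_int _ intf).
rewrite preimage_setT => /(_ intp measurableT) <-.
by apply: eq_measure_integral; first exact: measurable_pair_cons.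
Qed.

Definition set_tnth n (y : n.-tuple R) (i : 'I_n) (s : R) : n.-tuple R :=
  [tuple if j == i then s else tnth y j | j < n].

Lemma tnth_set_tnth n (y : n.-tuple R) i s j :
  tnth (set_tnth y i s) j = if j == i then s else tnth y j.
Proof. by rewrite tnth_mktuple. Qed.

Lemma tnth_pair_cons0 n (x : R) (y : n.-tuple R) :
  tnth (pair_cons (x, y)) ord0 = x.
Proof. by []. Qed.

Lemma tnth_pair_consS n (x : R) (y : n.-tuple R) j :
  tnth (pair_cons (x, y)) (lift ord0 j) = tnth y j.
Proof. by rewrite tnthS. Qed.

Lemma set_tnth_pair_cons0 n (x : R) (y : n.-tuple R) s :
  set_tnth (pair_cons (x, y)) ord0 s = pair_cons (s, y).
Proof.
apply: eq_from_tnth => j; rewrite tnth_set_tnth.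
case: (unliftP ord0 j) => [k|] ->; last by rewrite eqxx.
by rewrite eq_sym (negbTE (neq_lift _ _)) !tnth_pair_consS.
Qed.

Lemma set_tnth_pair_consS n (x : R) (y : n.-tuple R) i s :
  set_tnth (pair_cons (x, y)) (lift ord0 i) s = pair_cons (x, set_tnth y i s).
Proof.
apply: eq_from_tnth => j; rewrite tnth_set_tnth.
case: (unliftP ord0 j) => [k|] ->; last by rewrite (negbTE (neq_lift _ _)).
by rewrite !tnth_pair_consS tnth_set_tnth (inj_eq lift_inj).
Qed.

(** Fubini in the i-th coordinate. Almost every slice of an integrable function
    is integrable, so the hypothesis is only required of integrable slices; this
    spares separate integrability proofs on chords. *)
Lemma integral_tuple_slice0 n (i : 'I_n) (f : n.-tuple R -> \bar R) :
  (lebesgue_tuple n).-integrable setT f ->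
  (forall y, mu.-integrable setT (fun s => f (set_tnth y i s)) ->
    \int[mu]_s f (set_tnth y i s) = 0) ->
  \int[lebesgue_tuple n]_y f y = 0.
Proof.
elim: n i f => [[]//|n IHn] i f intf f0.
have intp := integrable_pair_cons intf; rewrite integral_tupleS//.
have [j ij|i0] := unliftP ord0 i.
  rewrite -integral12_prod_meas1//.
  transitivity (\int[mu]_(x in setT) (cst 0 x : \bar R)).
    apply: ae_eq_integral => //; first exact: (measurable_fubini_F intp).
    have := ae_integrable1 intp; apply: filterS => x intx _.
    apply: (IHn j) => // y h; apply: etrans (f0 (pair_cons (x, y)) _); rewrite ij.
      by apply: eq_integral => s _; rewrite set_tnth_pair_consS.
    by under eq_fun do rewrite set_tnth_pair_consS.
  by rewrite integral0.
rewrite -integral21_prod_meas1//.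
transitivity (\int[lebesgue_tuple n]_(x in setT) (cst 0 x : \bar R)).
  apply: ae_eq_integral => //; first exact: (measurable_fubini_G intp).
  have := ae_integrable2 intp; apply: filterS => y inty _.
  apply: etrans (f0 (pair_cons (0%R, y)) _); rewrite i0.
    by apply: eq_integral => s _; rewrite set_tnth_pair_cons0.
  by under eq_fun do rewrite set_tnth_pair_cons0.
by rewrite integral0.
Qed.

Definition affine_tuple n (x : n.-tuple R) (t : R) (z : n.-tuple R) : n.-tuple R :=
  [tuple (tnth x i + t * tnth z i)%R | i < n].

Lemma measurable_affine_tuple n (x : n.-tuple R) (t : R) :
  measurable_fun setT (affine_tuple x t).
Proof.
apply/measurable_fun_tnthP => i.
rewrite (_ : _ \o _ = fun z => (tnth x i + t * tnth z i)%R); last first.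
  by apply/funext => z /=; rewrite tnth_mktuple.
apply: measurable_funD => //; apply: measurable_funM => //.
exact: measurable_tnth.
Qed.

Lemma affine_pair_cons n (x : n.+1.-tuple R) (t s : R) (z : n.-tuple R) :
  affine_tuple x t (pair_cons (s, z)) =
  pair_cons ((thead x + t * s)%R, affine_tuple [tuple of behead x] t z).
Proof.
apply: eq_from_tnth => j; rewrite tnth_mktuple.
case: (unliftP ord0 j) => [k|] ->; last by [].
rewrite !tnth_pair_consS tnth_mktuple tnth_behead; congr (tnth _ _ + _)%R.
by apply: val_inj; rewrite /= inordK// ltnS.
Qed.

Lemma ge0_integral_affine_tuple n (x : n.-tuple R) t (f : n.-tuple R -> \bar R) :
  (0 < t)%R -> measurable_fun setT f -> (forall y, 0 <= f y) ->
  \int[lebesgue_tuple n]_y f y =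
  (t ^+ n)%:E * \int[lebesgue_tuple n]_z f (affine_tuple x t z).
Proof.
move=> t0; elim: n x f => [|n IHn] x f mf f0.
  rewrite expr0 mul1e !ge0_integral_tuple0//.
    by rewrite (tuple0 (affine_tuple _ _ _)).
  exact: measurableT_comp (measurable_affine_tuple _ _).
have mfa : measurable_fun setT (f \o affine_tuple x t).
  exact: measurableT_comp (measurable_affine_tuple _ _).
rewrite ge0_integral_tupleS// (ge0_integral_affine (thead x) t0); last 2 first.
- exact: measurable_slice_integral.
- by move=> s; apply: integral_ge0.
rewrite exprS EFinM -muleA; congr (_ * _).
rewrite (ge0_integral_tupleS mfa (fun z => f0 _)) -ge0_integralZl//; last 3 first.
- exact: (measurable_slice_integral mfa (fun z => f0 _)).
- by move=> s _; apply: integral_ge0 => z _; exact: f0.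
- by rewrite lee_fin exprn_ge0// ltW.
apply: eq_integral => s _; rewrite (IHn [tuple of behead x])//; last exact: measurable_slice.
by congr (_ * _); apply: eq_integral => z _; rewrite /= affine_pair_cons.
Qed.

End lebesgue_tuple_integrals.

(** * Measurability of continuous functions of several variables *)

Section continuous_on_tuples.
Context {R : realType} {n : nat}.

Lemma row_of_tupleE (y : n.-tuple R) i : row_of_tuple y 0 i = tnth y i.
Proof. by rewrite mxE. Qed.

Let box (q : 'rV[rat]_n) (k : nat) : set 'rV[R]_n :=
  [set p | forall i, `|p 0 i - ratr (q 0 i)| < k.+1%:R^-1].

Let measurable_box q k : measurable (@row_of_tuple R n @^-1` box q k).
Proof.
rewrite (_ : _ @^-1` _ = \bigcap_(i in [set: 'I_n])
    [set y | `|tnth y i - ratr (q 0 i)| < k.+1%:R^-1]); last first.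
  apply/seteqP; split => [y h i _|y h i] /=.
    by have := h i; rewrite row_of_tupleE.
  by rewrite row_of_tupleE; exact: h.
apply: fin_bigcap_measurable => // i _.
have mi : measurable_fun setT (fun y : n.-tuple R => `|tnth y i - ratr (q 0 i)|).
  apply: measurableT_comp => //; apply: measurable_funB => //.
  exact: measurable_tnth.
rewrite -[X in measurable X]setTI.
rewrite (_ : [set y | _] = (fun y : n.-tuple R => `|tnth y i - ratr (q 0 i)|) @^-1`
   [set x | x < k.+1%:R^-1]) //.
apply: mi => //.
by rewrite (_ : [set x | _] = `]-oo, k.+1%:R^-1[%classic)// set_itvE.
Qed.

(** An open set is a countable union of rational boxes; the Borel structure of
    tuples is generated by coordinates, so boxes are measurable. *)
Lemma measurable_open_rows (U : set 'rV[R]_n) : open U ->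
  measurable (@row_of_tuple R n @^-1` U).
Proof.
move=> oU.
rewrite (_ : U = \bigcup_(p in [set p : 'rV[rat]_n * nat | box p.1 p.2 `<=` U])
   box p.1 p.2); last first.
  apply/seteqP; split => [p Up|p [q /=]]; last by move=> + ?; apply.
  have /nbhs_ballP[e /= e0 eU] := open_nbhs_nbhs (conj oU Up).
  have e2 : 0 < e / 2 by rewrite divr_gt0.
  have [k _ hk] : \forall k \near \oo, k.+1%:R^-1 <= e / 2.
    have /cvgrPdist_le/(_ _ e2) := @cvg_harmonic R.
    apply: filterS => k /=; rewrite sub0r normrN ger0_norm//.
  have {}hk := hk k (leqnn k).
  have hq i : exists q : rat, `|p 0 i - ratr q| < k.+1%:R^-1.
    have k0 : 0 < k.+1%:R^-1 :> R by rewrite invr_gt0.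
    have /rat_in_itvoo[q] : p 0 i < p 0 i + k.+1%:R^-1 by rewrite ltrDl.
    rewrite in_itv/= => /andP[h1 h2]; exists q.
    rewrite distrC ger0_norm ?subr_ge0; last exact: ltW.
    by rewrite ltrBlDl.
  have [q qP] := choice hq.
  exists (\row_i q i, k); last by move=> i; rewrite mxE; exact: qP.
  move=> z /= zq; apply: eU; rewrite /ball /= /mx_ball; split => // j i.
  rewrite ord1 /ball /=.
  have h1 := qP i; have h2 := zq i; rewrite mxE in h2.
  rewrite -(subrK (ratr (q i)) (p 0 i)) -addrA.
  apply: le_lt_trans (ler_normD _ _) _.
  rewrite [X in _ + X < _]distrC; apply: lt_le_trans (ltrD h1 h2) _.
  by apply: le_trans (lerD hk hk) _; rewrite -splitr.
rewrite preimage_bigcup bigcup_mkcond; apply: countable_bigcupT_measurable => //.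
by move=> i; case: ifP => // _; exact: measurable_box.
Qed.

Lemma measurable_continuous_rows (f : 'rV[R]_n -> R) : continuous f ->
  measurable_fun setT (f \o @row_of_tuple R n).
Proof.
move=> /continuousP cf; apply: (measurability _ (RGenOpens.measurableE R)).
move=> _ [_ [a [b ->] <-]]; rewrite setTI comp_preimage.
by apply: measurable_open_rows; apply: cf; exact: interval_open.
Qed.

End continuous_on_tuples.

(** * The total mass of the weight *)

Section weight.
Context {R : realType}.
Notation mu := (@lebesgue_measure R).
Local Notation RM := (measurableTypeR R).

Definition sqnorm n (y : n.-tuple R) : R := \sum_(i < n) tnth y i ^+ 2.

Lemma sqnorm_ge0 n (y : n.-tuple R) : 0 <= sqnorm y.
Proof. by apply: sumr_ge0 => i _; exact: sqr_ge0. Qed.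

Lemma measurable_sqnorm n : measurable_fun setT (@sqnorm n).
Proof.
apply: measurable_sum => i; apply: measurable_funX.
exact: measurable_tnth.
Qed.

Lemma sqnorm_pair_cons n (x : R) (y : n.-tuple R) :
  sqnorm (pair_cons (x, y)) = x ^+ 2 + sqnorm y.
Proof.
rewrite /sqnorm big_ord_recl tnth_pair_cons0; congr (_ + _).
by apply: eq_bigr => i _; rewrite tnth_pair_consS.
Qed.

Lemma sqnorm_affine0 n (t : R) (z : n.-tuple R) :
  sqnorm (affine_tuple [tuple 0 | i < n] t z) = t ^+ 2 * sqnorm z.
Proof.
rewrite /sqnorm mulr_sumr; apply: eq_bigr => i _.
by rewrite !tnth_mktuple add0r exprMn.
Qed.

Lemma integral_gauss_tuple n :
  (\int[lebesgue_tuple n]_y (expR (- sqnorm y))%:E =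
   (pi `^ (n%:R / 2))%:E)%E.
Proof.
have mg m : measurable_fun setT (fun y : m.-tuple R => (expR (- sqnorm y))%:E).
  apply/measurable_EFinP; apply: measurableT_comp; first exact: measurable_expR.
  by apply: measurableT_comp => //; exact: measurable_sqnorm.
elim: n => [|n IHn].
  rewrite ge0_integral_tuple0//.
  by rewrite /sqnorm big_ord0 oppr0 expR0 mul0r powRr0.
rewrite ge0_integral_tupleS//.
transitivity (\int[mu]_x ((expR (- x ^+ 2))%:E * (pi `^ (n%:R / 2))%:E))%E.
  apply: eq_integral => x _.
  rewrite -IHn -ge0_integralZl//=; last exact: (mg n).
  apply: eq_integral => y _.
  by rewrite sqnorm_pair_cons opprD expRD EFinM.
rewrite ge0_integralZr//=; last 2 first.
- by apply/measurable_EFinP; exact: measurable_gauss_fun.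
- by rewrite lee_fin powR_ge0.
rewrite [X in (X * _)%E](_ : _ = (Num.sqrt pi)%:E); last exact: integralT_gauss.
rewrite -powR12_sqrt ?pi_ge0// -EFinM -powRD; last first.
  by rewrite gt_eqF ?pi_gt0 ?implybT.
by congr (_ `^ _)%:E; rewrite -natr1; field.
Qed.

(** Extended by zero outside the open unit ball, so that all integrals can be
    taken over the whole space. *)
Definition weight (a : R) n (z : n.-tuple R) : R :=
  if sqnorm z < 1 then (1 - sqnorm z) `^ a else 0.

Lemma weight_ge0 a n (z : n.-tuple R) : 0 <= weight a z.
Proof. by rewrite /weight; case: ifP => // _; exact: powR_ge0. Qed.

Lemma measurable_weight a n : measurable_fun setT (@weight a n).
Proof.
apply: measurable_fun_ifT => //.
  by apply: measurable_fun_ltr => //; exact: measurable_sqnorm.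
apply: (measurableT_comp (measurable_powR a)).
by apply: measurable_funB => //; exact: measurable_sqnorm.
Qed.

Variables (n : nat) (a : R).
Hypothesis a_lt1 : a < 1.
Let s : R := n%:R / 2 - a.

(* The kernel whose integral over (r, y) is computed in two orders. *)
Let F (p : RM * n.-tuple R) : \bar R :=
  if sqnorm p.2 < p.1 then (expR (- p.1) * (p.1 - sqnorm p.2) `^ (- a))%:E
  else 0%E.

Let F0 p : (0 <= F p)%E.
Proof.
by rewrite /F; case: ifP => // _; rewrite lee_fin mulr_ge0 ?expR_ge0 ?powR_ge0.
Qed.

Let mq : measurable_fun setT (fun p : RM * n.-tuple R => sqnorm p.2).
Proof. exact: measurableT_comp (@measurable_sqnorm n) measurable_snd. Qed.

Let mF : measurable_fun setT F.
Proof.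
apply: measurable_fun_ifT => //.
  exact: measurable_fun_ltr.
apply/measurable_EFinP; apply: measurable_funM.
  exact: measurableT_comp measurable_expRN measurable_fst.
apply: (measurableT_comp (measurable_powR (- a))).
exact: measurable_funB.
Qed.

(* Translating r by |y|^2 separates the variables. *)
Let intFr (y : n.-tuple R) :
  (\int[mu]_r F (r, y) = (expR (- sqnorm y))%:E * eGamma (1 - a))%E.
Proof.
have mFy : measurable_fun setT (fun r : RM => F (r, y)).
  exact: measurableT_comp mF (pair2_measurable y).
rewrite (ge0_integral_affine (sqnorm y) (t := 1))//.
rewrite mul1e /eGamma -ge0_integralZl//=; last 2 first.
- by apply/measurable_EFinP; apply: measurable_funTS; exact: measurable_gamma_fun.
- by move=> x _; rewrite lee_fin gamma_fun_ge0.
rewrite [RHS]integral_mkcond; apply: eq_integral => r _.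
rewrite patchE mem_setE in_itv/= andbT /F /= mul1r ltrDl; case: ifPn => // _.
rewrite -EFinM /gamma_fun opprD expRD addrAC subrr add0r.
have -> : 1 - a - 1 = - a by ring.
by congr EFin; ring.
Qed.

(* Scaling y by the square root of r separates the variables. *)
Let intFy (r : RM) : 0 < r ->
  (\int[lebesgue_tuple n]_y F (r, y) =
   (gamma_fun (s + 1) r)%:E * \int[lebesgue_tuple n]_z (weight (- a) z)%:E)%E.
Proof.
move=> r0.
have mFr : measurable_fun setT (fun y => F (r, y)).
  exact: measurableT_comp mF (pair1_measurable r).
have sr0 : 0 < Num.sqrt r by rewrite sqrtr_gt0.
rewrite (ge0_integral_affine_tuple [tuple 0 | i < n] sr0)//.
have -> : gamma_fun (s + 1) r = Num.sqrt r ^+ n * (expR (- r) * r `^ (- a)).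
  rewrite /gamma_fun addrK /s.
  rewrite -powR12_sqrt ?ltW// -powR_mulrn ?powR_ge0// -powRrM.
  have -> : 2^-1 * n%:R = n%:R / 2 :> R by rewrite mulrC.
  rewrite powRD; last by rewrite (gt_eqF r0) implybT.
  by rewrite -[LHS]mulrA [_ `^ (- a) * _]mulrC.
rewrite EFinM -muleA; congr (_ * _)%E.
rewrite -ge0_integralZl//=; last 3 first.
- by apply/measurable_EFinP; exact: measurable_weight.
- by move=> z _; rewrite lee_fin weight_ge0.
- by rewrite lee_fin mulr_ge0 ?expR_ge0 ?powR_ge0.
apply: eq_integral => z _; rewrite /F /= sqnorm_affine0 sqr_sqrtr ?ltW// /weight.
rewrite -{2}[r]mulr1 ltr_pM2l//; case: ifPn => // z1; last by rewrite mule0.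
rewrite -EFinM -mulrA; congr (_ * _)%:E.
by rewrite -powRM ?ltW ?subr_gt0// mulrBr mulr1.
Qed.

(** Finiteness of the left-hand side is part of the claim: its product with the
    nonzero number Gamma(s+1) is finite. *)
Lemma integral_weight : 0 < s < 1 ->
  (\int[lebesgue_tuple n]_z (weight (- a) z)%:E =
   (pi `^ (n%:R / 2) * Gamma (1 - a) / (s * Gamma s))%:E)%E.
Proof.
move=> s01; have /andP[s0 s1] := s01.
have a1 : 0 < 1 - a by rewrite subr_gt0.
have Gs : Gamma s != 0.
  have := Gamma_reflection s01; apply: contra_eq_neq => ->.
  by rewrite mulr0 mul0r lt_eqF ?pi_gt0.
have sG : s * Gamma s != 0 by rewrite mulf_neq0// gt_eqF.
set K := (\int[_]_z _)%E.
have K0 : (0 <= K)%E by apply: integral_ge0 => z _; rewrite lee_fin weight_ge0.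
have : (K * (s * Gamma s)%:E = (pi `^ (n%:R / 2) * Gamma (1 - a))%:E)%E.
  have := fubini_tonelli (m1 := mu) (m2 := lebesgue_tuple n) _ mF F0.
  rewrite [X in _ = X -> _](_ : _ = (pi `^ (n%:R / 2) * Gamma (1 - a))%:E); last first.
    under eq_integral do rewrite intFr.
    rewrite ge0_integralZr//=; last 2 first.
    - apply/measurable_EFinP; apply: measurableT_comp; first exact: measurable_expR.
      by apply: measurableT_comp => //; exact: measurable_sqnorm.
    - exact: eGamma_ge0.
    by rewrite integral_gauss_tuple eGammaK// -EFinM.
  have sp : 0 < s + 1 by exact: addr_gt0.
  move=> <-; rewrite -GammaS// -eGammaK//.
  rewrite /eGamma muleC -ge0_integralZr//=; last 2 first.
  - by apply/measurable_EFinP; apply: measurable_funTS; exact: measurable_gamma_fun.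
  - by move=> x _; rewrite lee_fin gamma_fun_ge0.
  rewrite [LHS]integral_mkcond; apply: eq_integral => r _.
  rewrite patchE mem_setE in_itv/= andbT; case: ifPn => [r0|].
    by rewrite intFy.
  rewrite -leNgt => r0; apply/esym/integral0_eq => y _.
  by rewrite /F /= ltNge (le_trans r0 (sqnorm_ge0 _)).
move: K0; case: K => [k| |] //= _.
  by move=> h; congr EFin; rewrite -(EFin_inj h) mulfK.
by rewrite gt0_mulye// lte_fin lt_neqAle eq_sym sG mulr_ge0 ?Gamma_ge0 ?ltW.
Qed.

End weight.

(** * Partial derivatives and their symmetry *)

Section directional.
Context {R : realType} {d : nat}.
Implicit Types (f h : 'rV[R]_d -> R) (x v : 'rV[R]_d).

Definition dpart (i : 'I_d) f : 'rV[R]_d -> R := 'D_(delta_mx 0 i) f.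

Lemma is_derive_line h x v (s : R) : differentiable h (x + s *: v) ->
  is_derive s 1 (fun s => h (x + s *: v)) ('D_v h (x + s *: v)).
Proof.
move=> dh.
have E : (fun r : R => r^-1 *: (((fun s => h (x + s *: v)) \o shift s) (r *: 1)
    - h (x + s *: v))) =
  (fun r : R => r^-1 *: ((h \o shift (x + s *: v)) (r *: v) - h (x + s *: v))).
  apply/funext => r /=; congr (_ *: (h _ - _)).
  by rewrite [r%:A]mulr1 scalerDl addrCA.
apply: DeriveDef; last by rewrite /derive E.
by rewrite /derivable E; exact: diff_derivable.
Qed.

Lemma derive_sum_dpart h x v : differentiable h x ->
  'D_v h x = \sum_(i < d) v 0 i * dpart i h x.
Proof.
move=> dh; rewrite deriveE// {1}[v]row_sum_delta linear_sum.
by apply: eq_bigr => i _; rewrite linearZ /dpart deriveE.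
Qed.

Lemma is_derive_line_sum h x v (s : R) : differentiable h (x + s *: v) ->
  is_derive s 1 (fun s => h (x + s *: v))
    (\sum_(i < d) v 0 i * dpart i h (x + s *: v)).
Proof. by move=> dh; rewrite -derive_sum_dpart//; exact: is_derive_line. Qed.

Lemma is_derive_line_dpart h x i (s : R) :
  differentiable h (x + s *: delta_mx 0 i) ->
  is_derive s 1 (fun s => h (x + s *: delta_mx 0 i))
    (dpart i h (x + s *: delta_mx 0 i)).
Proof. exact: is_derive_line. Qed.

Lemma is_derive_dpart h x i (l : R) :
  is_derive (0 : R) 1 (fun s => h (x + s *: delta_mx 0 i)) l ->
  derivable h x (delta_mx 0 i) /\ dpart i h x = l.
Proof.
have E : (fun r : R => r^-1 *: (((fun s => h (x + s *: delta_mx 0 i)) \o shift 0) (r *: 1)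
    - h (x + (0 : R) *: delta_mx 0 i))) =
  (fun r : R => r^-1 *: ((h \o shift x) (r *: delta_mx 0 i) - h x)).
  apply/funext => r /=; rewrite scale0r addr0 [r%:A]mulr1 addr0.
  by rewrite [x + _]addrC.
by move=> [dh <-]; split; [move: dh; rewrite /derivable E|rewrite /derive E].
Qed.

(** All iterated derivatives are included so that the class is closed under
    [dpart]. Boundedness can replace rapid decay because the integrals run over
    balls. *)
Definition smooth_bounded f := forall s : seq 'I_d,
  (forall x, differentiable (foldr dpart f s) x) /\
  exists C : R, forall x, `|foldr dpart f s x| <= C.

Lemma smooth_bounded_dpart i f : smooth_bounded f -> smooth_bounded (dpart i f).
Proof. by move=> sf s; have := sf (rcons s i); rewrite foldr_rcons. Qed.

Lemma smooth_bounded_differentiable f : smooth_bounded f ->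
  forall x, differentiable f x.
Proof. by move=> sf; case: (sf [::]). Qed.

Lemma smooth_bounded_continuous f : smooth_bounded f -> continuous f.
Proof.
by move=> sf x; apply: differentiable_continuous; exact: smooth_bounded_differentiable.
Qed.

Lemma smooth_bounded_bound f : smooth_bounded f -> exists C : R, forall x, `|f x| <= C.
Proof. by move=> sf; case: (sf [::]). Qed.

(* The mean value theorem in direction i, then in direction j. *)
Let second_difference f i j x (e : R) :
  smooth_bounded f -> 0 < e ->
  exists2 p : R * R, 0 < p.1 < e /\ 0 < p.2 < e &
  f (x + e *: delta_mx 0 i + e *: delta_mx 0 j) - f (x + e *: delta_mx 0 i)
   - f (x + e *: delta_mx 0 j) + f x =
  e ^+ 2 * dpart j (dpart i f) (x + p.1 *: delta_mx 0 i + p.2 *: delta_mx 0 j).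
Proof.
move=> sf e0.
have sfi := smooth_bounded_dpart i sf.
pose psi (s : R) := f (x + e *: delta_mx 0 j + s *: delta_mx 0 i) -
                    f (x + s *: delta_mx 0 i).
pose dpsi (s : R) := dpart i f (x + e *: delta_mx 0 j + s *: delta_mx 0 i) -
                    dpart i f (x + s *: delta_mx 0 i).
have dp (s : R) : is_derive s 1 psi (dpsi s).
  apply: is_deriveB; apply: is_derive_line_dpart;
    exact: smooth_bounded_differentiable.
have cp : {within `[0, e], continuous psi}.
  by apply: continuous_subspaceT => y; exact: is_derive_cvg.
have [s se hs] := MVT e0 (fun s _ => dp s) cp.
pose chi (r : R) := dpart i f (x + s *: delta_mx 0 i + r *: delta_mx 0 j).
have dc (r : R) : is_derive r 1 chi
   (dpart j (dpart i f) (x + s *: delta_mx 0 i + r *: delta_mx 0 j)).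
  by apply: is_derive_line_dpart; exact: smooth_bounded_differentiable.
have cc : {within `[0, e], continuous chi}.
  by apply: continuous_subspaceT => y; exact: is_derive_cvg.
have [r re hr] := MVT e0 (fun r _ => dc r) cc.
exists (s, r); first by move: se re; rewrite !in_itv.
have -> : f (x + e *: delta_mx 0 i + e *: delta_mx 0 j) -
    f (x + e *: delta_mx 0 i) - f (x + e *: delta_mx 0 j) + f x = psi e - psi 0.
  by rewrite /psi !scale0r !addr0 [x + e *: delta_mx 0 j + _]addrAC; ring.
rewrite hs /dpsi [x + e *: delta_mx 0 j + _]addrAC.
have -> : dpart i f (x + s *: delta_mx 0 i + e *: delta_mx 0 j) -
  dpart i f (x + s *: delta_mx 0 i) = chi e - chi 0.
  by rewrite /chi scale0r addr0.
by rewrite hr /= subr0; ring.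
Qed.

(** The second difference of f is symmetric in i and j, and by the mean value
    theorem it is e^2 times either mixed derivative at points close to x. *)
Lemma dpartC f i j x : smooth_bounded f ->
  dpart i (dpart j f) x = dpart j (dpart i f) x.
Proof.
move=> sf; apply/eqP; rewrite -subr_eq0 -normr_le0; apply/ler_addgt0Pr => eps eps0.
rewrite add0r.
have near_x h : smooth_bounded h -> exists2 e, 0 < e &
    forall s r k l, 0 < s < e -> 0 < r < e ->
    `|h x - h (x + s *: delta_mx 0 k + r *: delta_mx 0 l)| <= eps / 2.
  move=> /smooth_bounded_continuous/(_ x)/cvgrPdist_le.
  have eps2 : 0 < eps / 2 by rewrite divr_gt0.
  move=> /(_ _ eps2)/nbhs_ballP[e /= e0 he].
  exists (e / 2); first by rewrite divr_gt0.
  move=> s r k l /andP[s0 se] /andP[r0 re]; apply: he => /=.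
  rewrite /ball /= /mx_ball; split => // m n; rewrite /ball /= !mxE.
  rewrite opprD opprD addrA addNKr -opprD normrN ger0_norm; last first.
    by rewrite addr_ge0// mulr_ge0 ?ler0n// ltW.
  have b (c : bool) (y : R) : 0 < y -> y * c%:R <= y.
    by move=> y0; rewrite ger_pMr// lern1 leq_b1.
  apply: le_lt_trans (lerD (b _ _ s0) (b _ _ r0)) _.
  by rewrite [e]splitr ltrD.
have [e1 e10 he1] := near_x _ (smooth_bounded_dpart i (smooth_bounded_dpart j sf)).
have [e2 e20 he2] := near_x _ (smooth_bounded_dpart j (smooth_bounded_dpart i sf)).
pose e := Num.min e1 e2.
have e0 : 0 < e by rewrite lt_min e10.
have [[s r] /= [/andP[s0 se] /andP[r0 re]] E1] := second_difference i j x sf e0.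
have [[s' r'] /= [/andP[s0' se'] /andP[r0' re']] E2] := second_difference j i x sf e0.
(* Both mixed derivatives, at two different points, equal the second difference. *)
have E : dpart j (dpart i f) (x + s *: delta_mx 0 i + r *: delta_mx 0 j) =
  dpart i (dpart j f) (x + s' *: delta_mx 0 j + r' *: delta_mx 0 i).
  have en0 : e ^+ 2 != 0 by rewrite expf_neq0// gt_eqF.
  apply: (mulfI en0); apply: etrans (esym E1) _; apply: etrans E2.
  by rewrite [x + e *: delta_mx 0 j + e *: delta_mx 0 i]addrAC; ring.
have lt1 y : y < e -> y < e1 by rewrite lt_min => /andP[].
have lt2 y : y < e -> y < e2 by rewrite lt_min => /andP[].
have h1 := he1 s' r' j i (introT andP (conj s0' (lt1 _ se')))
  (introT andP (conj r0' (lt1 _ re'))).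
have h2 := he2 s r i j (introT andP (conj s0 (lt2 _ se)))
  (introT andP (conj r0 (lt2 _ re))).
rewrite E in h2; rewrite (splitr eps); apply: le_trans (lerD h1 h2).
rewrite [X in _ <= _ + X]distrC; apply: le_trans (ler_normD _ _).
by rewrite addrA subrK.
Qed.

End directional.

(** * Differentiation under the integral sign *)

Section real_integrals.
Context {dsp : measure_display} {T : measurableType dsp} {R : realType}.
Variable mu : {measure set T -> \bar R}.
Implicit Types (f g k : T -> R).

Lemma integrable_dominated f k : measurable_fun setT f ->
  mu.-integrable setT (EFin \o k) -> (forall x, `|f x| <= `|k x|) ->
  mu.-integrable setT (EFin \o f).
Proof.
move=> mf ik fk; apply: le_integrable ik => //.
- exact/measurable_EFinP.
- by move=> x _ /=; rewrite lee_fin.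
Qed.

Lemma integrable_bounded_mul (C : R) f k : measurable_fun setT f ->
  (forall x, k x != 0 -> `|f x| <= C) -> mu.-integrable setT (EFin \o k) ->
  mu.-integrable setT (EFin \o (fun x => f x * k x)).
Proof.
move=> mf fC ik.
have mk : measurable_fun setT k by apply/measurable_EFinP; exact: measurable_int ik.
apply: (@integrable_dominated _ (fun x => C * k x)).
- exact: measurable_funM.
- exact: integrable_scale.
- move=> x; rewrite !normrM; have [->|kx] := eqVneq (k x) 0.
    by rewrite normr0 !mulr0.
  by rewrite ler_wpM2r// (le_trans (fC _ kx))// ler_norm.
Qed.

Lemma integrable_sum_ord n (F : 'I_n -> T -> R) :
  (forall i, mu.-integrable setT (EFin \o F i)) ->
  mu.-integrable setT (EFin \o (fun x => \sum_(i < n) F i x)).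
Proof.
move=> iF; elim: n F iF => [|n IHn] F iF.
  rewrite (_ : _ \o _ = cst 0%E); first exact: integrable0.
  by apply/funext => x /=; rewrite big_ord0.
rewrite (_ : _ \o _ = EFin \o (fun x => F ord0 x + \sum_(i < n) F (lift ord0 i) x)).
  by apply: integrable_add => //; exact: IHn.
by apply/funext => x /=; rewrite big_ord_recl.
Qed.

Lemma Rintegral_sum_ord n (F : 'I_n -> T -> R) :
  (forall i, mu.-integrable setT (EFin \o F i)) ->
  \int[mu]_x (\sum_(i < n) F i x) = \sum_(i < n) \int[mu]_x F i x.
Proof.
move=> iF; elim: n F iF => [|n IHn] F iF.
  rewrite big_ord0; under eq_Rintegral do rewrite big_ord0.
  by rewrite /Rintegral integral0.
rewrite big_ord_recl -IHn// -RintegralD//; last exact: integrable_sum_ord.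
by apply: eq_Rintegral => x _; rewrite big_ord_recl.
Qed.

End real_integrals.

Section line_derivative.
Context {R : realType} {d : nat}.
Local Notation lam := (@lebesgue_tuple R d).
Variables (A B : d.-tuple R -> 'rV[R]_d) (k : d.-tuple R -> R).
Hypothesis mAB : forall (g : 'rV[R]_d -> R) (s : R), continuous g ->
  measurable_fun setT (fun z => g (A z + s *: B z)).
Hypothesis mB : forall i, measurable_fun setT (fun z => B z 0 i).
Hypothesis ik : lam.-integrable setT (EFin \o k).
Hypothesis B1 : forall z i, k z != 0 -> `|B z 0 i| <= 1.

Lemma integrable_line (h : 'rV[R]_d -> R) s : smooth_bounded h ->
  lam.-integrable setT (EFin \o (fun z => h (A z + s *: B z) * k z)).
Proof.
move=> sh; have [C hC] := smooth_bounded_bound sh.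
apply: (@integrable_bounded_mul _ _ _ _ C) => //.
exact: (@mAB h s (smooth_bounded_continuous sh)).
Qed.

Lemma integrable_line_mul (h : 'rV[R]_d -> R) s i : smooth_bounded h ->
  lam.-integrable setT (EFin \o (fun z => h (A z + s *: B z) * (B z 0 i * k z))).
Proof.
move=> sh; have [C hC] := smooth_bounded_bound sh.
apply: (@integrable_bounded_mul _ _ _ _ C) => //.
  exact: (@mAB h s (smooth_bounded_continuous sh)).
apply: (@integrable_bounded_mul _ _ _ _ 1) => // z; exact: B1.
Qed.

(** The point moves along a line whose direction B z may depend on z: B z = z
    gives the derivative in time of a ball mean, a constant B its partial
    derivatives in space. Since k contains the weight, which vanishes off the
    ball, B is controlled where k does not vanish. *)
Lemma is_derive_integral_line (h : 'rV[R]_d -> R) (s : R) : smooth_bounded h ->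
  is_derive s 1 (fun s => \int[lam]_z (h (A z + s *: B z) * k z))
    (\sum_(i < d) \int[lam]_z (dpart i h (A z + s *: B z) * (B z 0 i * k z))).
Proof.
move=> sh.
pose f (r : R) (z : d.-tuple R) := h (A z + r *: B z) * k z.
have df (r : R) (z : d.-tuple R) : is_derive r 1 (f ^~ z)
    (\sum_(i < d) dpart i h (A z + r *: B z) * (B z 0 i * k z)).
  have dh : is_derive r 1 (fun r => h (A z + r *: B z))
     (\sum_(i < d) B z 0 i * dpart i h (A z + r *: B z)).
    by apply: is_derive_line_sum; exact: smooth_bounded_differentiable.
  rewrite /f; apply: is_derive_eq; rewrite scaler0 add0r /GRing.scale /=.
  rewrite mulr_sumr; apply: eq_bigr => i _; ring.
have /choice[C hC] : forall i, exists C : R, forall x, `|dpart i h x| <= C.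
  by move=> i; exact/smooth_bounded_bound/smooth_bounded_dpart.
have C0 i : 0 <= C i by apply: le_trans (hC i 0).
pose G z := (\sum_(i < d) C i) * `|k z|.
have G0 z : 0 <= G z by rewrite mulr_ge0// sumr_ge0.
have iG : lam.-integrable setT (EFin \o G).
  apply: integrable_scale => //.
  exact: integrable_norm.
have s01 : `]s - 1, s + 1[%classic s.
  by rewrite /= in_itv/=; apply/andP; split; lra.
have intf (r : R) : `]s - 1, s + 1[%classic r -> lam.-integrable setT (EFin \o f r).
  by move=> _; exact: integrable_line.
have der (r : R) (z : d.-tuple R) :
    `]s - 1, s + 1[%classic r -> setT z -> derivable (f ^~ z) r 1.
  by move=> _ _; case: (df r z).
have ub (r : R) (z : d.-tuple R) :
    `]s - 1, s + 1[%classic r -> setT z -> `|partial1of2 f r z| <= G z.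
  move=> _ _; rewrite partial1of2E; have [_ ->] := df r z.
  apply: le_trans (ler_norm_sum _ _ _) _; rewrite /G mulr_suml.
  apply: ler_sum => i _; rewrite !normrM.
  have [->|kz] := eqVneq (k z) 0; first by rewrite normr0 !mulr0.
  rewrite ler_pM ?mulr_ge0// -[leRHS]mul1r ler_wpM2r//.
  exact: B1.
apply: DeriveDef.
  exact: (derivable_under_integral measurableT s01 intf der G0 iG ub).
rewrite -derive1E (differentiation_under_integral measurableT s01 intf der G0 iG ub).
rewrite -Rintegral_sum_ord; last first.
  by move=> i; apply: integrable_line_mul; exact: smooth_bounded_dpart.
by apply: eq_Rintegral => z _; rewrite /= partial1of2E; have [_ ->] := df s z.
Qed.

End line_derivative.

(** * Integration by parts against the weight *)

Section integration_by_parts.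
Context {R : realType} {d : nat}.
Notation mu := (@lebesgue_measure R).
Local Notation lam := (@lebesgue_tuple R d).
Variable a : R.
Hypothesis a_lt1 : a < 1.
Hypothesis iw : lam.-integrable setT (EFin \o @weight R (- a) d).

Lemma sqnorm_set_tnth (y : d.-tuple R) i s :
  sqnorm (set_tnth y i s) = s ^+ 2 + \sum_(j < d | j != i) tnth y j ^+ 2.
Proof.
rewrite /sqnorm (bigD1 i)//= tnth_set_tnth eqxx; congr (_ + _).
by apply: eq_bigr => j /negbTE ji; rewrite tnth_set_tnth ji.
Qed.

Lemma weight_onem (z : d.-tuple R) :
  weight (1 - a) z = (1 - sqnorm z) * weight (- a) z.
Proof.
rewrite /weight; case: ifPn => [z1|]; last by rewrite mulr0.
have q0 : 1 - sqnorm z != 0 by rewrite gt_eqF// subr_gt0.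
by rewrite powRD ?q0 ?implybT// powRr1// subr_ge0 ltW.
Qed.

Lemma tnth_le1 (z : d.-tuple R) i : weight (- a) z != 0 -> `|tnth z i| <= 1.
Proof.
rewrite /weight; case: ifPn => [z1 _|]; last by rewrite eqxx.
rewrite -(@expr_le1 _ 2)// -normrX ger0_norm ?sqr_ge0//.
apply: le_trans (ltW z1); rewrite /sqnorm (bigD1 i)//= lerDl.
by apply: sumr_ge0 => j _; exact: sqr_ge0.
Qed.

Lemma onem_sqnorm_le1 (z : d.-tuple R) : weight (- a) z != 0 ->
  `|1 - sqnorm z| <= 1.
Proof.
rewrite /weight; case: ifPn => [z1 _|]; last by rewrite eqxx.
have := sqnorm_ge0 z => z0; rewrite ger0_norm; first by rewrite gerBl.
by rewrite subr_ge0 ltW.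
Qed.

Lemma integrable_weight_onem : lam.-integrable setT (EFin \o @weight R (1 - a) d).
Proof.
rewrite (_ : _ \o _ = EFin \o (fun z => (1 - sqnorm z) * weight (- a) z)).
  apply: (@integrable_bounded_mul _ _ _ _ 1) => //.
    by apply: measurable_funB => //; exact: measurable_sqnorm.
  exact: onem_sqnorm_le1.
by apply/funext => z /=; rewrite weight_onem.
Qed.

Lemma weight_onem_neq0 (z : d.-tuple R) : weight (1 - a) z != 0 ->
  weight (- a) z != 0.
Proof. by rewrite weight_onem mulf_eq0 negb_or => /andP[]. Qed.

(* The integrand is the derivative of H(s) (1 - rho - s^2)^(1-a) on the chord
   s^2 < 1 - rho, and 1 - a > 0 makes this function vanish at both ends. *)
Let chord_integral (rho : R) (H H' : R -> R) :
  (forall s : R, is_derive s 1 H (H' s)) -> continuous H' ->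
  let f s := if s ^+ 2 + rho < 1 then
      H' s * (1 - (s ^+ 2 + rho)) `^ (1 - a) -
      2 * (1 - a) * (s * (H s * (1 - (s ^+ 2 + rho)) `^ (- a))) else 0 in
  mu.-integrable setT (EFin \o f) ->
  (\int[mu]_s (f s)%:E = 0)%E.
Proof.
move=> dH cH' f intf.
have [rho1|rho1] := leP 1 rho.
  apply: integral0_eq => s _; rewrite /f ltNge (le_trans rho1)//.
  by rewrite lerDr sqr_ge0.
pose r : R := Num.sqrt (1 - rho).
have r0 : 0 < r by rewrite sqrtr_gt0 subr_gt0.
have r2 : r ^+ 2 = 1 - rho by rewrite sqr_sqrtr// subr_ge0 ltW.
have inr s : (s ^+ 2 + rho < 1) = (- r < s < r).
  by rewrite -ltrBrDr -r2 -ltr_norml -[s ^+ 2]ger0_norm ?sqr_ge0// normrX ltr_pXn2r ?nnegrE// ltW.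
pose g (s : R) : R := H' s * (1 - (s ^+ 2 + rho)) `^ (1 - a) -
      2 * (1 - a) * (s * (H s * (1 - (s ^+ 2 + rho)) `^ (- a))).
have fE s : f s = (g \_ `]- r, r[) s.
  by rewrite patchE mem_setE in_itv/= /f inr.
have gE : (\int[mu]_s (f s)%:E = \int[mu]_(s in `](- r)%R, r[) (g s)%:E)%E.
  rewrite [RHS]integral_mkcond; apply: eq_integral => s _.
  by rewrite fE !patchE; case: ifP.
have posr s : - r < s < r -> 0 < 1 - (s ^+ 2 + rho).
  by rewrite -inr subr_gt0.
have dq (s : R) : is_derive s 1 (fun s : R => 1 - (s ^+ 2 + rho)) (- (2 * s)).
  by apply: is_derive_eq; rewrite /GRing.scale/=; ring.
have dP (b s : R) : - r < s < r -> is_derive s 1 (fun s => (1 - (s ^+ 2 + rho)) `^ b)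
    (b * (1 - (s ^+ 2 + rho)) `^ (b - 1) * (- (2 * s))).
  move=> /posr q0; have h := is_derive1_powR b q0.
  exact: (is_derive1_comp (f := fun x => x `^ b) (g := fun s => 1 - (s ^+ 2 + rho)) h (dq s)).
have cP (b s : R) : - r < s < r ->
    (1 - (s' ^+ 2 + rho)) `^ b @[s' --> s] --> (1 - (s ^+ 2 + rho)) `^ b.
  by move=> /(dP b); exact: is_derive_cvg.
have a1 : 0 < 1 - a by rewrite subr_gt0.
have cH (s : R) : H s' @[s' --> s] --> H s by exact: is_derive_cvg.
have intg : mu.-integrable `]- r, r[ (EFin \o g).
  have : mu.-integrable `]- r, r[ (EFin \o f) by apply: integrableS intf.
  apply: eq_integrable => // s; rewrite inE /= in_itv/= => sr.
  by rewrite fE patchE mem_setE in_itv/= sr.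
pose F s := H s * (1 - (s ^+ 2 + rho)) `^ (1 - a).
have F0 s : s ^+ 2 = r ^+ 2 -> F s = 0.
  move=> sr; rewrite /F sr r2 subrK subrr powR0 ?mulr0// gt_eqF//.
have rr : - r < r by rewrite gtrN.
have cq0 (s : R) : s ^+ 2 = r ^+ 2 -> 1 - (s' ^+ 2 + rho) @[s' --> s] --> (0 : R).
  move=> sr; rewrite -[X in _ --> X](_ : 1 - (s ^+ 2 + rho) = 0).
    exact: is_derive_cvg.
  by rewrite sr r2 subrK subrr.
(* The power is only controlled as its base tends to 0 from the right, so the
   positivity of the base inside the chord enters here. *)
have F_end (s : R) (G : set_system R) (FG : ProperFilter G) :
    G `=>` nbhs s -> (\forall s' \near G, - r < s' < r) -> s ^+ 2 = r ^+ 2 ->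
    F x @[x --> G] --> F s.
  move=> Gs Gr sr; rewrite F0// -(mulr0 (H s)); apply: cvgM.
    exact: cvg_trans (cvg_app _ Gs) (cH s).
  apply: (@cvg_comp _ _ _ (fun s' => 1 - (s' ^+ 2 + rho)) (fun x => x `^ (1 - a))
    _ 0^'+); last exact: powR_cvg0.
  move=> P [e /= e0 eP].
  have /cvgrPdist_lt/(_ _ e0) h : 1 - (s' ^+ 2 + rho) @[s' --> G] --> (0 : R).
    exact: cvg_trans (cvg_app _ Gs) (cq0 s sr).
  apply: filterS2 h Gr => x /= h xr; apply: eP => //=.
  exact: posr.
transitivity ((F r - F (- r))%:E); last by rewrite !F0 ?sqrrN// subrr.
rewrite gE; apply: (@integrable_FTC2_oo _ g F) => //.
- move=> s; rewrite in_itv/= => sr; rewrite /g.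
  apply: cvgB; first by apply: cvgM; [exact: cH'|exact: cP].
  apply: cvgM; first exact: cvg_cst.
  apply: cvgM; first exact: cvg_id.
  by apply: cvgM; [exact: cH|exact: cP].
- move=> s sr; have h1 := dP (1 - a) s sr; have h2 := dH s.
  rewrite /F; apply: is_derive_eq; rewrite /GRing.scale /= /g.
  have -> : 1 - a - 1 = - a by ring.
  ring.
- apply: F_end; last by rewrite sqrrN.
    exact: cvg_within.
  near=> s; apply/andP; split; near: s.
    exact: nbhs_right_gt.
  exact: nbhs_right_lt.
- apply: F_end => //.
    exact: cvg_within.
  near=> s; apply/andP; split; near: s.
    exact: nbhs_left_gt.
  exact: nbhs_left_lt.
Unshelve. all: by end_near. Qed.

(** The weight with exponent 1 - a is an antiderivative along axis i of
    - 2 (1 - a) z_i times the weight with exponent - a. It vanishes on the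
    sphere, so no boundary term appears, although its derivative is
    unbounded. *)
Lemma weight_by_parts (i : 'I_d) (H H' : d.-tuple R -> R) (C : R) :
  measurable_fun setT H -> measurable_fun setT H' ->
  (forall z, weight (- a) z != 0 -> `|H z| <= C) ->
  (forall z, weight (- a) z != 0 -> `|H' z| <= C) ->
  (forall y (s : R), is_derive s 1 (fun s => H (set_tnth y i s)) (H' (set_tnth y i s))) ->
  (forall y, continuous (fun s : R => H' (set_tnth y i s))) ->
  2 * (1 - a) * \int[lam]_z (H z * (tnth z i * weight (- a) z)) =
  \int[lam]_z (H' z * weight (1 - a) z).
Proof.
move=> mH mH' HC HC' dH cH'.
have mi : measurable_fun setT (fun z : d.-tuple R => tnth z i).
  exact: measurable_tnth.
have i1 : lam.-integrable setT (EFin \o (fun z => tnth z i * weight (- a) z)).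
  by apply: (@integrable_bounded_mul _ _ _ _ 1) => // z; exact: tnth_le1.
have i2 : lam.-integrable setT (EFin \o (fun z => H z * (tnth z i * weight (- a) z))).
  apply: (@integrable_bounded_mul _ _ _ _ C) => // z.
  by rewrite mulf_eq0 negb_or => /andP[_]; exact: HC.
have i3 : lam.-integrable setT (EFin \o (fun z => H' z * weight (1 - a) z)).
  apply: (@integrable_bounded_mul _ _ _ _ C) => //; last exact: integrable_weight_onem.
  by move=> z /weight_onem_neq0; exact: HC'.
(* The difference of both sides is one integral all of whose slices vanish. *)
apply/esym/eqP; rewrite -subr_eq0 -RintegralZl// -RintegralB//; last exact: integrable_scale.
apply/eqP; rewrite /Rintegral.
have iF : lam.-integrable setT (EFin \o (fun z => H' z * weight (1 - a) z +
    (- (2 * (1 - a))) * (H z * (tnth z i * weight (- a) z)))).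
  by apply: integrable_add => //; exact: integrable_scale.
rewrite (_ : (fun z => _) = (EFin \o (fun z => H' z * weight (1 - a) z +
    (- (2 * (1 - a))) * (H z * (tnth z i * weight (- a) z))))); last first.
  by apply/funext => z /=; rewrite mulNr.
rewrite (integral_tuple_slice0 (i := i))//= => y.
set rho := \sum_(j < d | j != i) tnth y j ^+ 2.
have E s : H' (set_tnth y i s) * weight (1 - a) (set_tnth y i s) +
    - (2 * (1 - a)) * (H (set_tnth y i s) *
       (tnth (set_tnth y i s) i * weight (- a) (set_tnth y i s))) =
   if s ^+ 2 + rho < 1 then
      H' (set_tnth y i s) * (1 - (s ^+ 2 + rho)) `^ (1 - a) -
      2 * (1 - a) * (s * (H (set_tnth y i s) * (1 - (s ^+ 2 + rho)) `^ (- a))) else 0.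
  rewrite /weight sqnorm_set_tnth -/rho tnth_set_tnth eqxx.
  case: ifP => _; last by rewrite !mulr0 addr0.
  ring.
move=> h.
transitivity (\int[mu]_s (if s ^+ 2 + rho < 1 then
      H' (set_tnth y i s) * (1 - (s ^+ 2 + rho)) `^ (1 - a) -
      2 * (1 - a) * (s * (H (set_tnth y i s) * (1 - (s ^+ 2 + rho)) `^ (- a))) else 0)%:E)%E.
  by apply: eq_integral => s _; rewrite E.
apply: (chord_integral (H := fun s => H (set_tnth y i s)) (dH y) (cH' y)).
move: h; congr (integrable _ _ _); apply/funext => s /=; congr EFin; exact: E.
Qed.

End integration_by_parts.

(** * The Darboux equation *)

Section darboux.
Context {R : realType} {d : nat}.
Local Notation lam := (@lebesgue_tuple R d).
Local Notation row := (@row_of_tuple R d).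
Implicit Types (h f : 'rV[R]_d -> R).

Lemma measurable_affine_rows h (x : 'rV[R]_d) (t : R) : continuous h ->
  measurable_fun setT (fun z => h (x + t *: row z)).
Proof.
move=> ch; apply: (@measurable_continuous_rows _ _ (fun y => h (x + t *: y))) => y.
have cy : x + t *: y' @[y' --> y] --> x + t *: y.
  apply: (@cvgD R _ _ (nbhs y) _ (fun=> x) (fun y => t *: y)); first exact: cvg_cst.
  exact: scaler_continuous.
exact: (cvg_comp _ _ cy (ch _)).
Qed.

Lemma row_set_tnth (y : d.-tuple R) i (s : R) :
  row (set_tnth y i s) = row (set_tnth y i 0) + s *: delta_mx 0 i.
Proof.
apply/rowP => j; rewrite !mxE !tnth_set_tnth /=.
by case: eqP => _; rewrite ?add0r ?mulr1// mulr0 addr0.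
Qed.

Variable a : R.
Hypothesis a_lt1 : a < 1.
Hypothesis iw : lam.-integrable setT (EFin \o @weight R (- a) d).
Local Notation w := (weight (- a)).
Local Notation W := (weight (1 - a)).

Variables (x : 'rV[R]_d) (t : R).

(* Chain rule for z |-> h (x + t z) along the i-th axis. *)
Let der_slice h i (y : d.-tuple R) (s : R) : smooth_bounded h ->
  is_derive s 1 (fun s : R => h (x + t *: row (set_tnth y i s)))
    (t * dpart i h (x + t *: row (set_tnth y i s))).
Proof.
move=> sh.
have E (r : R) : x + t *: row (set_tnth y i r) =
    (x + t *: row (set_tnth y i 0)) + r *: (t *: delta_mx 0 i).
  by rewrite row_set_tnth scalerDr !scalerA [t * r]mulrC addrA.
rewrite (_ : (fun s : R => _) = fun r : R => h ((x + t *: row (set_tnth y i 0)) +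
  r *: (t *: delta_mx 0 i))); last by apply/funext => r; rewrite E.
rewrite (E s); set x0 := x + _; set v := t *: _.
have : is_derive s 1 (fun r : R => h (x0 + r *: v))
    (\sum_(j < d) v 0 j * dpart j h (x0 + s *: v)).
  by apply: is_derive_line_sum; exact: smooth_bounded_differentiable.
suff -> : \sum_(j < d) v 0 j * dpart j h (x0 + s *: v) =
    t * dpart i h (x0 + s *: v) by [].
rewrite (bigD1 i)//= big1 ?addr0; last first.
  by move=> j /negbTE ji; rewrite [v 0 j]mxE [delta_mx _ _ _ _]mxE ji andbF mulr0 mul0r.
by congr (_ * _); rewrite mxE mxE !eqxx mulr1.
Qed.

Let cont_slice h i (y : d.-tuple R) : smooth_bounded h ->
  continuous (fun s : R => h (x + t *: row (set_tnth y i s))).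
Proof. by move=> sh s; exact: is_derive_cvg (der_slice _ _ _ sh). Qed.

Let rowC (z : d.-tuple R) i : row z 0 i = tnth z i.
Proof. exact: row_of_tupleE. Qed.

(** [weight_by_parts] for H(z) = h (x + t z). *)
Lemma by_parts1 i h : smooth_bounded h ->
  2 * (1 - a) * \int[lam]_z (h (x + t *: row z) * (row z 0 i * w z)) =
  t * \int[lam]_z (dpart i h (x + t *: row z) * W z).
Proof.
move=> sh; have sh' := smooth_bounded_dpart i sh.
have [C hC] := smooth_bounded_bound sh; have [C' hC'] := smooth_bounded_bound sh'.
have C0 : 0 <= C by apply: le_trans (hC 0).
have C'0 : 0 <= C' by apply: le_trans (hC' 0).
under eq_Rintegral do rewrite rowC.
transitivity (\int[lam]_z (t * dpart i h (x + t *: row z) * W z)); last first.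
  rewrite -RintegralZl//.
    by apply: eq_Rintegral => z _; rewrite mulrA.
  apply: (@integrable_bounded_mul _ _ _ _ C') => //.
    by apply: measurable_affine_rows; exact: smooth_bounded_continuous.
  exact: integrable_weight_onem.
apply: (@weight_by_parts _ _ a a_lt1 iw i (fun z => h (x + t *: row z))
  (fun z => t * dpart i h (x + t *: row z)) (C + `|t| * C')).
- by apply: measurable_affine_rows; exact: smooth_bounded_continuous.
- apply: measurable_funM => //.
  by apply: measurable_affine_rows; exact: smooth_bounded_continuous.
- by move=> z _; apply: le_trans (hC _) _; rewrite lerDl mulr_ge0.
- move=> z _; rewrite normrM; apply: (@le_trans _ _ (`|t| * C')).
    by rewrite ler_wpM2l.
  by rewrite lerDr.
- by move=> y s; exact: der_slice.
- move=> y s; apply: cvgM; first exact: cvg_cst.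
  exact: cont_slice.
Qed.

(** [weight_by_parts] for H(z) = z_j h (x + t z). *)
Lemma by_parts2 i j h : smooth_bounded h ->
  2 * (1 - a) * \int[lam]_z (h (x + t *: row z) * (row z 0 j * (row z 0 i * w z))) =
  (j == i)%:R * \int[lam]_z (h (x + t *: row z) * W z) +
  t * \int[lam]_z (dpart i h (x + t *: row z) * (row z 0 j * W z)).
Proof.
move=> sh; have sh' := smooth_bounded_dpart i sh.
have [C hC] := smooth_bounded_bound sh; have [C' hC'] := smooth_bounded_bound sh'.
have C0 : 0 <= C by apply: le_trans (hC 0).
have C'0 : 0 <= C' by apply: le_trans (hC' 0).
have mj : measurable_fun setT (fun z : d.-tuple R => tnth z j).
  exact: measurable_tnth.
have mh : measurable_fun setT (fun z => h (x + t *: row z)).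
  by apply: measurable_affine_rows; exact: smooth_bounded_continuous.
have mh' : measurable_fun setT (fun z => dpart i h (x + t *: row z)).
  by apply: measurable_affine_rows; exact: smooth_bounded_continuous.
have iW := integrable_weight_onem iw.
rewrite (_ : \int[lam]_z (h (x + t *: row z) * (row z 0 j * (row z 0 i * w z))) =
  \int[lam]_z ((tnth z j * h (x + t *: row z)) * (tnth z i * w z))); last first.
  by apply: eq_Rintegral => z _; rewrite !rowC; ring.
transitivity (\int[lam]_z (((j == i)%:R * h (x + t *: row z) +
     tnth z j * (t * dpart i h (x + t *: row z))) * W z)); last first.
  have i1 : lam.-integrable setT (EFin \o (fun z => h (x + t *: row z) * W z)).
    exact: (@integrable_bounded_mul _ _ _ _ C).
  have i2 : lam.-integrable setT (EFin \o (fun z => dpart i h (x + t *: row z) *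
      (row z 0 j * W z))).
    apply: (@integrable_bounded_mul _ _ _ _ C') => //.
    apply: (@integrable_bounded_mul _ _ _ _ 1) => //.
      by under eq_fun do rewrite rowC.
    by move=> z /weight_onem_neq0 z1; rewrite rowC; exact: tnth_le1 z1.
  rewrite -!RintegralZl// -RintegralD//; [|exact: integrable_scale..].
  by apply: eq_Rintegral => z _; rewrite rowC; ring.
apply: (@weight_by_parts _ _ a a_lt1 iw i (fun z => tnth z j * h (x + t *: row z))
  (fun z => (j == i)%:R * h (x + t *: row z) +
     tnth z j * (t * dpart i h (x + t *: row z))) (C + `|t| * C')).
- exact: measurable_funM.
- by apply: measurable_funD; apply: measurable_funM => //; exact: measurable_funM.
- move=> z /tnth_le1 z1; rewrite normrM -[leRHS]mul1r ler_pM//.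
  by apply: le_trans (hC _) _; rewrite lerDl mulr_ge0.
- move=> z /tnth_le1 z1; apply: le_trans (ler_normD _ _) _; apply: lerD.
    rewrite normrM -[leRHS]mul1r ler_pM// ger0_norm//.
    by rewrite lern1 leq_b1.
  rewrite !normrM -[leRHS]mul1r ler_pM// ?mulr_ge0//.
  by rewrite ler_wpM2l.
- move=> y s; have h1 := der_slice i y s sh.
  have h2 : is_derive s 1 (fun s : R => tnth (set_tnth y i s) j) ((j == i)%:R : R).
    have [->|ji] := eqVneq j i.
      rewrite (_ : (fun s : R => _) = id); first exact: is_derive_id.
      by apply/funext => r; rewrite tnth_set_tnth eqxx.
    rewrite (_ : (fun s : R => _) = cst (tnth y j)); first exact: is_derive_cst.
    by apply/funext => r; rewrite tnth_set_tnth (negbTE ji).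
  apply: is_derive_eq; rewrite /GRing.scale/=; ring.
- move=> y s; apply: cvgD.
    by apply: cvgM; [exact: cvg_cst|exact: cont_slice].
  apply: cvgM; last by apply: cvgM; [exact: cvg_cst|exact: cont_slice].
  under eq_fun do rewrite tnth_set_tnth; rewrite tnth_set_tnth.
  by case: eqP => _; [exact: cvg_id|exact: cvg_cst].
Qed.

(** Because w = W + |z|^2 w. *)
Lemma integral_weight_split h : smooth_bounded h ->
  \int[lam]_z (h (x + t *: row z) * w z) =
  \int[lam]_z (h (x + t *: row z) * W z) +
  \sum_(i < d) \int[lam]_z (h (x + t *: row z) * (row z 0 i * (row z 0 i * w z))).
Proof.
move=> sh; have [C hC] := smooth_bounded_bound sh.
have mh : measurable_fun setT (fun z => h (x + t *: row z)).
  by apply: measurable_affine_rows; exact: smooth_bounded_continuous.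
have mi (i : 'I_d) : measurable_fun setT (fun z => row z 0 i).
  by under eq_fun do rewrite rowC; exact: measurable_tnth.
have b1 (i : 'I_d) z : w z != 0 -> `|row z 0 i| <= 1.
  by rewrite rowC; exact: tnth_le1.
have i2 i : lam.-integrable setT (EFin \o (fun z => h (x + t *: row z) *
    (row z 0 i * (row z 0 i * w z)))).
  apply: (@integrable_bounded_mul _ _ _ _ C) => //.
  apply: (@integrable_bounded_mul _ _ _ _ 1) => //.
    by move=> z; rewrite mulf_eq0 negb_or => /andP[_]; exact: b1.
  by apply: (@integrable_bounded_mul _ _ _ _ 1) => // z; exact: b1.
have iW := integrable_weight_onem iw.
rewrite -Rintegral_sum_ord// -RintegralD//; last first.
- exact: integrable_sum_ord.
- exact: (@integrable_bounded_mul _ _ _ _ C).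
apply: eq_Rintegral => z _; rewrite weight_onem// -mulr_sumr.
under eq_bigr do rewrite mulrA rowC -expr2.
by rewrite -mulr_suml -/(sqnorm z); ring.
Qed.

(** The equation M_tt + (1 + 2 sigma) / t M_t = Delta M, with
    1 + 2 sigma = d + 1 - 2 a and all derivatives moved inside. *)
Lemma darboux_integral f : smooth_bounded f -> t != 0 ->
  \sum_(i < d) \sum_(j < d) \int[lam]_z
     (dpart j (dpart i f) (x + t *: row z) * (row z 0 j * (row z 0 i * w z))) +
  (d%:R + 1 - 2 * a) / t *
  \sum_(i < d) \int[lam]_z (dpart i f (x + t *: row z) * (row z 0 i * w z)) =
  \sum_(i < d) \int[lam]_z (dpart i (dpart i f) (x + t *: row z) * w z).
Proof.
move=> sf t0.
have sfi i := smooth_bounded_dpart i sf.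
have sfij i j := smooth_bounded_dpart j (sfi i).
pose L := \sum_(i < d) \int[lam]_z (dpart i (dpart i f) (x + t *: row z) * W z).
pose N := \sum_(i < d) \sum_(j < d) \int[lam]_z
   (dpart j (dpart i (dpart i f)) (x + t *: row z) * (row z 0 j * W z)).
have k0 : 2 * (1 - a) != 0 by rewrite mulf_neq0// subr_eq0 gt_eqF.
apply: (mulfI k0); rewrite mulrDr.
(* After multiplication by 2 (1 - a), M_tt becomes L + t N, the term in M_t
   becomes (1 + 2 sigma) L, and Delta M becomes (2 (1 - a) + d) L + t N. *)
have -> : 2 * (1 - a) * \sum_(i < d) \sum_(j < d) \int[lam]_z
     (dpart j (dpart i f) (x + t *: row z) * (row z 0 j * (row z 0 i * w z))) =
   L + t * N.
  rewrite /L /N !mulr_sumr -big_split/=; apply: eq_bigr => i _.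
  rewrite !mulr_sumr; under eq_bigr do rewrite by_parts2//.
  have E1 : \sum_(j < d) (j == i)%:R *
      \int[lam]_z (dpart j (dpart i f) (x + t *: row z) * W z) =
      \int[lam]_z (dpart i (dpart i f) (x + t *: row z) * W z).
    rewrite (bigD1 i)//= eqxx mul1r big1 ?addr0// => j /negbTE ->.
    by rewrite mul0r.
  have E2 j : \int[lam]_z (dpart i (dpart j (dpart i f)) (x + t *: row z) *
      (row z 0 j * W z)) =
      \int[lam]_z (dpart j (dpart i (dpart i f)) (x + t *: row z) *
      (row z 0 j * W z)).
    by apply: eq_Rintegral => z _; rewrite (dpartC i j (x + t *: row z) (sfi i)).
  under eq_bigr do rewrite E2.
  by rewrite big_split/= E1.
have -> : 2 * (1 - a) * ((d%:R + 1 - 2 * a) / t *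
  \sum_(i < d) \int[lam]_z (dpart i f (x + t *: row z) * (row z 0 i * w z))) =
  (d%:R + 1 - 2 * a) * L.
  rewrite mulrCA /L mulr_sumr.
  under eq_bigr do rewrite by_parts1//.
  by rewrite -mulr_sumr mulrA divfK.
have -> : 2 * (1 - a) *
  \sum_(i < d) \int[lam]_z (dpart i (dpart i f) (x + t *: row z) * w z) =
  (2 * (1 - a) + d%:R) * L + t * N.
  have E3 i : 2 * (1 - a) * \int[lam]_z (dpart i (dpart i f) (x + t *: row z) * w z) =
      (2 * (1 - a) + d%:R) * \int[lam]_z (dpart i (dpart i f) (x + t *: row z) * W z) +
      t * \sum_(j < d) \int[lam]_z (dpart j (dpart i (dpart i f)) (x + t *: row z) *
        (row z 0 j * W z)).
    rewrite integral_weight_split//.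
    rewrite [LHS](mulrDr (2 * (1 - a))) [X in _ + X = _]mulr_sumr.
    under eq_bigr do rewrite by_parts2// eqxx mul1r.
    rewrite big_split/= sumr_const card_ord -mulr_sumr -[_ *+ d]mulr_natl.
    by rewrite (mulrDl (2 * (1 - a)) d%:R) addrA.
  rewrite mulr_sumr; under eq_bigr do rewrite E3.
  by rewrite big_split/= -!mulr_sumr.
ring.
Qed.

End darboux.

(** * Weighted ball means *)

Section weighted_mean.
Context {R : realType} {d : nat}.
Local Notation lam := (@lebesgue_tuple R d).
Local Notation row := (@row_of_tuple R d).
Implicit Types (h f : 'rV[R]_d -> R) (x : 'rV[R]_d) (t : R).
Variable a : R.
Hypothesis iw : lam.-integrable setT (EFin \o @weight R (- a) d).
Local Notation w := (weight (- a)).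

(** Not normalized: the total mass of the weight is left as a factor. *)
Definition mean f x t : R := \int[lam]_z (f (x + t *: row z) * w z).

Definition mean_dt f x t : R :=
  \sum_(i < d) \int[lam]_z (dpart i f (x + t *: row z) * (row z 0 i * w z)).

Definition mean_dtt f x t : R :=
  \sum_(i < d) \sum_(j < d) \int[lam]_z
     (dpart j (dpart i f) (x + t *: row z) * (row z 0 j * (row z 0 i * w z))).

Let measurable_row i : measurable_fun setT (fun z => row z 0 i).
Proof. by under eq_fun do rewrite row_of_tupleE; exact: measurable_tnth. Qed.

Let row_le1 (z : d.-tuple R) i : w z != 0 -> `|row z 0 i| <= 1.
Proof. by rewrite row_of_tupleE; exact: tnth_le1. Qed.

Lemma is_derive_mean f x t : smooth_bounded f ->
  is_derive t 1 (mean f x) (mean_dt f x t).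
Proof.
move=> sf.
apply: (@is_derive_integral_line R d (fun=> x) row (@weight R (- a) d)
  _ _ _ _ f t) => //.
by move=> g s cg; exact: measurable_affine_rows.
Qed.

Lemma is_derive_mean_dt f x t : smooth_bounded f ->
  is_derive t 1 (mean_dt f x) (mean_dtt f x t).
Proof.
move=> sf; rewrite (_ : mean_dt f x = \sum_(i < d)
    (fun t => \int[lam]_z (dpart i f (x + t *: row z) * (row z 0 i * w z)))); last first.
  by apply/funext => s; rewrite fct_sumE.
apply: is_derive_sum => i.
apply: (@is_derive_integral_line R d (fun=> x) row (fun z => row z 0 i * w z)
  _ _ _ _ (dpart i f) t) => //.
- by move=> g s cg; exact: measurable_affine_rows.
- by apply: (@integrable_bounded_mul _ _ _ _ 1) => // z; exact: row_le1.
- by move=> z j; rewrite mulf_eq0 negb_or => /andP[_]; exact: row_le1.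
- exact: smooth_bounded_dpart.
Qed.

Lemma mean_dpart f x t i (c : R) : smooth_bounded f ->
  derivable (fun x => c * mean f x t) x (delta_mx 0 i) /\
  dpart i (fun x => c * mean f x t) x = c * mean (dpart i f) x t.
Proof.
move=> sf; apply: is_derive_dpart.
have -> : (fun s => c * mean f (x + s *: delta_mx 0 i) t) =
   (fun s => c * \int[lam]_z (f (x + t *: row z + s *: delta_mx 0 i) * w z)).
  apply/funext => s; congr (_ * _); apply: eq_Rintegral => z _.
  by rewrite addrAC.
have h : is_derive (0 : R) 1
   (fun s => \int[lam]_z (f (x + t *: row z + s *: delta_mx 0 i) * w z))
   (\sum_(j < d) \int[lam]_z (dpart j f (x + t *: row z + (0 : R) *: delta_mx 0 i) *
      ((delta_mx 0 i : 'rV[R]_d) 0 j * w z))).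
  apply: (@is_derive_integral_line R d (fun z => x + t *: row z)
    (fun=> delta_mx 0 i) (@weight R (- a) d) _ _ _ _ f 0) => //.
  - move=> g s cg; rewrite (_ : (fun z => _) =
      (fun z => g ((x + s *: delta_mx 0 i) + t *: row z))).
      exact: measurable_affine_rows.
    by apply/funext => z; rewrite addrAC.
  - move=> z j _; rewrite mxE eqxx /=; case: eqP => _; by rewrite ?normr1 ?normr0.
have := @is_deriveZ _ _ _ _ c _ _ _ h.
suff -> : \sum_(j < d) \int[lam]_z (dpart j f (x + t *: row z + (0 : R) *: delta_mx 0 i) *
      ((delta_mx 0 i : 'rV[R]_d) 0 j * w z)) = mean (dpart i f) x t by [].
rewrite (bigD1 i)//= [X in _ + X]big1 ?addr0.
  by apply: eq_Rintegral => z _; rewrite scale0r addr0 mxE !eqxx mul1r.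
move=> j /negbTE ji; rewrite /Rintegral integral0_eq// => z _.
by rewrite mxE ji andbF mul0r mulr0.
Qed.

End weighted_mean.

(** * Integrals over Euclidean balls *)

Lemma integral_affine_tuple (R : realType) n (x : n.-tuple R) (t : R)
    (f : n.-tuple R -> R) : 0 < t -> measurable_fun setT f ->
  (lebesgue_tuple n).-integrable setT (EFin \o (fun z => f (affine_tuple x t z))) ->
  (lebesgue_tuple n).-integrable setT (EFin \o f) /\
  \int[lebesgue_tuple n]_y f y =
    t ^+ n * \int[lebesgue_tuple n]_z f (affine_tuple x t z).
Proof.
move=> t0 mf intf; have tn0 : 0 < t ^+ n by rewrite exprn_gt0.
have mEf : measurable_fun setT (EFin \o f) by exact/measurable_EFinP.
have intEf : (lebesgue_tuple n).-integrable setT (EFin \o f).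
  apply/integrableP; split => //.
  rewrite (ge0_integral_affine_tuple x t0)//; last exact: measurableT_comp.
  move/integrableP : intf => [_ foo].
  by apply: lte_mul_pinfty => //; rewrite lee_fin ltW.
split => //; apply: EFin_inj; rewrite EFinM /Rintegral !fineK; last 2 first.
- by apply: integrable_fin_num.
- by apply: integrable_fin_num.
rewrite [LHS]integralE [in RHS]integralE.
rewrite (ge0_integral_affine_tuple x t0 (measurable_funepos mEf))//.
rewrite (ge0_integral_affine_tuple x t0 (measurable_funeneg mEf))//.
rewrite -muleBr//.
  congr (_ * (_ - _))%E; apply: eq_integral => z _.
    by rewrite !funeposE.
  by rewrite !funenegE.
apply: fin_num_adde_defr; apply: integrable_fin_num => //.
rewrite (_ : (fun z => _) = (EFin \o (fun z => f (affine_tuple x t z)))^\+%E).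
  exact: integrable_funepos.
by apply/funext => z; rewrite !funeposE.
Qed.

Section ball_integral.
Context {R : realType} {d : nat}.
Local Notation lam := (@lebesgue_tuple R d).
Local Notation row := (@row_of_tuple R d).
Variable a : R.
Hypothesis iw : lam.-integrable setT (EFin \o @weight R (- a) d).

Let tuple_of (x : 'rV[R]_d) : d.-tuple R := [tuple x 0 i | i < d].

Let row_affine (x : 'rV[R]_d) t z :
  row (affine_tuple (tuple_of x) t z) = x + t *: row z.
Proof. by apply/rowP => i; rewrite !mxE !tnth_mktuple. Qed.

Let eucl_affine (x : 'rV[R]_d) t z : 0 < t ->
  eucl_norm (x - row (affine_tuple (tuple_of x) t z)) = t * Num.sqrt (sqnorm z).
Proof.
move=> t0; rewrite row_affine opprD addNKr /eucl_norm.
rewrite (_ : \sum_(i < d) _ = t ^+ 2 * sqnorm z); last first.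
  by rewrite /sqnorm mulr_sumr; apply: eq_bigr => i _; rewrite !mxE sqrrN exprMn.
by rewrite sqrtrM ?sqr_ge0// sqrtr_sqr gtr0_norm.
Qed.

Let measurable_eucl (x : 'rV[R]_d) :
  measurable_fun setT (fun y => eucl_norm (x - row y)).
Proof.
have ms : measurable_fun setT (@Num.sqrt R : R -> R).
  by apply: continuous_measurable_fun; exact: sqrt_continuous.
apply: (measurableT_comp ms); apply: measurable_sum => i; apply: measurable_funX.
under eq_fun do rewrite !mxE; apply: measurable_funB => //.
exact: measurable_tnth.
Qed.

Let measurable_ball (x : 'rV[R]_d) t : measurable (row @^-1` eucl_ball x t).
Proof.
rewrite -[X in measurable X]setTI.
rewrite (_ : row @^-1` _ = (fun y => eucl_norm (x - row y)) @^-1` `]-oo, t[); last first.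
  by apply/seteqP; split => y; rewrite /eucl_ball /= in_itv.
exact: measurable_eucl.
Qed.

Lemma ball_integral (f : 'rV[R]_d -> R) (x : 'rV[R]_d) (t : R) :
  smooth_bounded f -> 0 < t ->
  let g y := f (row y) / (t ^+ 2 - eucl_norm (x - row y) ^+ 2) `^ a in
  lam.-integrable (row @^-1` eucl_ball x t) (EFin \o g) /\
  \int[lam]_(y in row @^-1` eucl_ball x t) g y =
    t `^ (d%:R - 2 * a) * mean a f x t.
Proof.
move=> sf t0 g; set D := row @^-1` _.
have [C hC] := smooth_bounded_bound sf.
have mg : measurable_fun setT (g \_ D).
  apply/(measurable_restrictT _ _).1; first exact: measurable_ball.
  apply: measurable_funTS; apply: measurable_funM.
    by apply: measurable_continuous_rows; exact: smooth_bounded_continuous.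
  under eq_fun do rewrite -powRN.
  apply: (measurableT_comp (measurable_powR (- a))).
  by apply: measurable_funB => //; exact: measurable_funX.
have gE z : (g \_ D) (affine_tuple (tuple_of x) t z) =
    t `^ (- (2 * a)) * (f (x + t *: row z) * weight (- a) z).
  have zD : (affine_tuple (tuple_of x) t z \in D) = (sqnorm z < 1).
    have -> : (sqnorm z < 1) = (eucl_norm (x - row (affine_tuple (tuple_of x) t z)) < t).
      by rewrite eucl_affine// gtr_pMr// -{2}sqrtr1 ltr_sqrt.
    by apply/idP/idP; rewrite inE.
  rewrite patchE zD.
  rewrite /weight; case: ifPn => z1; last by rewrite !mulr0.
  rewrite /g row_affine -row_affine eucl_affine// row_affine exprMn sqr_sqrtr ?sqnorm_ge0//.
  rewrite -[X in X - _]mulr1 -mulrBr powRM ?sqr_ge0 ?subr_ge0 ?(ltW z1)//.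
  rewrite invfM -!powRN -powR_mulrn ?(ltW t0)// -powRrM.
  by rewrite mulrCA mulrN.
have ig : lam.-integrable setT (EFin \o (fun z => (g \_ D) (affine_tuple (tuple_of x) t z))).
  rewrite (_ : _ \o _ = EFin \o (fun z =>
      t `^ (- (2 * a)) * (f (x + t *: row z) * weight (- a) z))).
    apply: integrable_scale => //; apply: (@integrable_bounded_mul _ _ _ _ C) => //.
    by apply: measurable_affine_rows; exact: smooth_bounded_continuous.
  by apply/funext => z /=; rewrite gE.
(* The substitution y = x + t z maps the unit ball onto the ball of radius t. *)
have [iD eD] := integral_affine_tuple t0 mg ig.
split.
  apply/integrable_mkcond; first exact: measurable_ball.
  by rewrite restrict_EFin.
rewrite Rintegral_mkcond eD; under eq_Rintegral do rewrite gE.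
rewrite RintegralZl//; last first.
  apply: (@integrable_bounded_mul _ _ _ _ C) => //.
  by apply: measurable_affine_rows; exact: smooth_bounded_continuous.
by rewrite mulrA -powR_mulrn ?(ltW t0)// -powRD// (gt_eqF t0) implybT.
Qed.

End ball_integral.

(** * The solution for real data *)

Section real_solution.
Context {R : realType} {d : nat}.
Implicit Types (x : 'rV[R]_d) (t : R).
Local Notation lam := (@lebesgue_tuple R d).
Local Notation row := (@row_of_tuple R d).
Variables (a c : R).
Hypothesis a_lt1 : a < 1.
Let q : R := d%:R - 2 * a.
Hypothesis q_gt0 : 0 < q.
Hypothesis iw : lam.-integrable setT (EFin \o @weight R (- a) d).
Variable f : 'rV[R]_d -> R.
Hypothesis sf : smooth_bounded f.

Definition solution (x : 'rV[R]_d) (t : R) : R :=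
  c * \int[lam]_(y in row @^-1` eucl_ball x t)
    (f (row y) / (t ^+ 2 - eucl_norm (x - row y) ^+ 2) `^ a).

Lemma solutionE x t : 0 < t -> solution x t = c * (t `^ q * mean a f x t).
Proof. by move=> t0; rewrite /solution (ball_integral iw x sf t0).2. Qed.

Let solution_dt x t : R :=
  c * (q * t `^ (q - 1) * mean a f x t + t `^ q * mean_dt a f x t).

Let solution_dtt x t : R :=
  c * (q * (q - 1) * t `^ (q - 1 - 1) * mean a f x t +
       2 * q * t `^ (q - 1) * mean_dt a f x t + t `^ q * mean_dtt a f x t).

Let near_pos (P : R -> Prop) (t : R) : 0 < t -> (forall s, 0 < s -> P s) ->
  \forall s \near t, P s.
Proof. by move=> t0 Ps; near=> s; apply: Ps; near: s; exact: lt_nbhsr. 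
Unshelve. all: by end_near. Qed.

(* The formulas below hold for positive times only; derivatives do not see the
   rest. *)
Let near_is_derive (g h : R -> R) (t dh : R) : 0 < t ->
  (forall s, 0 < s -> g s = h s) -> is_derive t 1 h dh -> is_derive t 1 g dh.
Proof.
move=> t0 gh [dht <-].
have nh : \forall s \near t, h s = g s by apply: near_pos => // s /gh.
apply: DeriveDef; first exact: near_eq_derivable nh dht.
by apply: near_eq_derive; apply: near_pos => // s /gh.
Qed.

Lemma is_derive_solution x t : 0 < t ->
  is_derive t 1 (solution x) (solution_dt x t).
Proof.
move=> t0; apply: (near_is_derive t0 (solutionE x)).
have h1 := is_derive1_powR q t0; have h2 := is_derive_mean iw x t sf.
by apply: is_derive_eq; rewrite /GRing.scale/= /solution_dt; ring.
Qed.

Lemma is_derive_solution_dt x t : 0 < t ->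
  is_derive t 1 ('D_1 (solution x)) (solution_dtt x t).
Proof.
move=> t0; have E s : 0 < s -> 'D_1 (solution x) s = solution_dt x s.
  by move=> s0; have [] := is_derive_solution x s0.
apply: (near_is_derive t0 E).
have h1 := is_derive1_powR q t0; have h2 := is_derive_mean iw x t sf.
have h3 := is_derive1_powR (q - 1) t0; have h4 := is_derive_mean_dt iw x t sf.
by rewrite /solution_dt; apply: is_derive_eq; rewrite /GRing.scale/= /solution_dtt; ring.
Qed.

Let solution_mean t : 0 < t ->
  (solution ^~ t) = fun x => c * t `^ q * mean a f x t.
Proof. by move=> t0; apply/funext => x; rewrite solutionE// mulrA. Qed.

Lemma dpart_solution i t : 0 < t ->
  dpart i (solution ^~ t) = fun x => c * t `^ q * mean a (dpart i f) x t.
Proof.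
move=> t0; apply/funext => x; rewrite solution_mean//.
by have [] := mean_dpart iw x t i (c * t `^ q) sf.
Qed.

Lemma derivable_solution_space x t i : 0 < t ->
  derivable (solution ^~ t) x (delta_mx 0 i).
Proof.
move=> t0; rewrite solution_mean//.
by have [] := mean_dpart iw x t i (c * t `^ q) sf.
Qed.

Lemma derivable_dpart_solution x t i : 0 < t ->
  derivable (dpart i (solution ^~ t)) x (delta_mx 0 i).
Proof.
move=> t0; rewrite dpart_solution//.
by have [] := mean_dpart iw x t i (c * t `^ q) (smooth_bounded_dpart i sf).
Qed.

(** Inserting u = c t^q M, the terms in M cancel, and c t^q times the Darboux
    equation remains. *)
Lemma solution_wave x t : 0 < t ->
  'D_1 ('D_1 (solution x)) t + (1 - q) / t * 'D_1 (solution x) t =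
  \sum_(i < d) dpart i (dpart i (solution ^~ t)) x.
Proof.
move=> t0; have t0' : t != 0 by rewrite gt_eqF.
have [_ ->] := is_derive_solution_dt x t0.
have [_ ->] := is_derive_solution x t0.
under eq_bigr => i _.
  rewrite dpart_solution// (mean_dpart iw x t i (c * t `^ q) (smooth_bounded_dpart i sf)).2.
  over.
rewrite -mulr_sumr.
have := darboux_integral a_lt1 iw x sf t0'.
rewrite -/(mean_dtt a f x t) -/(mean_dt a f x t) => D.
rewrite -[\sum_(i < d) mean _ _ _ _]D.
have tq1 : t `^ (q - 1) = t `^ q / t.
  by rewrite powRD ?t0' ?implybT// powR_inv1// ltW.
have tq2 : t `^ (q - 1 - 1) = t `^ q / t / t.
  by rewrite powRD ?t0' ?implybT// tq1 powR_inv1// ltW.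
rewrite /solution_dtt /solution_dt tq1 tq2 /q.
move: (mean _ _ _ _) (mean_dt _ _ _ _) (mean_dtt _ _ _ _) (t `^ _) => m m1 m2 p.
by field.
Qed.

Let cvg_id0 : t @[t --> (0 : R)^'+] --> (0 : R).
Proof. by apply: cvg_at_right_filter; exact: cvg_id. Qed.

Let cvg_mean0 x : mean a f x t @[t --> 0^'+] --> mean a f x 0.
Proof. by apply: cvg_at_right_filter; exact: is_derive_cvg (is_derive_mean iw x 0 sf). Qed.

Let cvg_mean_dt0 x : mean_dt a f x t @[t --> 0^'+] --> mean_dt a f x 0.
Proof.
by apply: cvg_at_right_filter; exact: is_derive_cvg (is_derive_mean_dt iw x 0 sf).
Qed.

Lemma mean0 x : mean a f x 0 = f x * \int[lam]_z weight (- a) z.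
Proof.
rewrite /mean -RintegralZl//; apply: eq_Rintegral => z _.
by rewrite scale0r addr0.
Qed.

Lemma cvg_solution0 x : solution x t @[t --> 0^'+] --> (0 : R).
Proof.
have h : c * (t `^ q * mean a f x t) @[t --> 0^'+] --> c * (0 * mean a f x 0).
  apply: cvgM; first exact: cvg_cst.
  by apply: cvgM; [exact: powR_cvg0|exact: cvg_mean0].
rewrite mul0r mulr0 in h; apply: cvg_trans h; apply: near_eq_cvg.
by near=> t; rewrite solutionE//; near: t; exact: nbhs_right_gt.
Unshelve. all: by end_near. Qed.

Lemma cvg_solution_dt0 x :
  q^-1 * t `^ (1 - q) * 'D_1 (solution x) t @[t --> 0^'+] -->
  f x * (c * \int[lam]_z weight (- a) z).
Proof.
have h : c * mean a f x t + c / q * (t * mean_dt a f x t) @[t --> 0^'+] -->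
    c * mean a f x 0 + c / q * (0 * mean_dt a f x 0).
  apply: cvgD; apply: cvgM; [exact: cvg_cst|exact: cvg_mean0|exact: cvg_cst|].
  by apply: cvgM; [exact: cvg_id0|exact: cvg_mean_dt0].
rewrite mul0r mulr0 addr0 mean0 mulrCA in h.
apply: cvg_trans h; apply: near_eq_cvg.
near=> t; have t0 : 0 < t by near: t; exact: nbhs_right_gt.
have t0' : t != 0 by rewrite gt_eqF.
have [_ ->] := is_derive_solution x t0; rewrite /solution_dt.
have tq1 : t `^ (q - 1) = t `^ q / t.
  by rewrite powRD ?t0' ?implybT// powR_inv1// ltW.
have tq2 : t `^ (1 - q) = t / t `^ q.
  by rewrite powRD ?t0' ?implybT// powRN powRr1// ltW.
have p0 : t `^ q != 0 by rewrite gt_eqF// powR_gt0.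
rewrite tq1 tq2; move: (t `^ q) p0 => p p0.
have q0 : q != 0 by rewrite gt_eqF.
move: (mean _ _ _ _) (mean_dt _ _ _ _) q0 => m m1; move: q => q' q0.
by field; rewrite t0' p0 q0.
Unshelve. all: by end_near. Qed.

End real_solution.

(** * Complex data and the initial value *)

Section components.
Context {R : realType}.
Implicit Types (z : R[i]) (r : R).

Lemma Re_div_real z r : complex.Re (z / r%:C) = complex.Re z / r.
Proof. by rewrite -fmorphV; case: z => p q /=; rewrite mulr0 subr0. Qed.

Lemma Im_div_real z r : complex.Im (z / r%:C) = complex.Im z / r.
Proof. by rewrite -fmorphV; case: z => p q /=; rewrite mulr0 add0r. Qed.

Lemma mul_real_complex r z :
  r%:C * z = (r * complex.Re z) +i* (r * complex.Im z).
Proof. by case: z => p q; apply/eqP; rewrite eq_complex /= !mul0r subr0 addr0 !eqxx. Qed.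

Lemma Re_sum n (F : 'I_n -> R[i]) :
  complex.Re (\sum_(i < n) F i) = \sum_(i < n) complex.Re (F i).
Proof. by apply: (big_morph (@complex.Re R)) => // -[? ?] [? ?]. Qed.

Lemma Im_sum n (F : 'I_n -> R[i]) :
  complex.Im (\sum_(i < n) F i) = \sum_(i < n) complex.Im (F i).
Proof. by apply: (big_morph (@complex.Im R)) => // -[? ?] [? ?]. Qed.

Lemma ler_norm_Re z (C : R) : `|z| <= C%:C -> `|complex.Re z| <= C.
Proof. by move=> zC; rewrite -lecR; exact: le_trans (normc_ge_Re z) zC. Qed.

Lemma ler_norm_Im z (C : R) : `|z| <= C%:C -> `|complex.Im z| <= C.
Proof.
rewrite normc_def lecR; apply: le_trans.
by rewrite -sqrtr_sqr ler_wsqrtr// lerDr sqr_ge0.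
Qed.

Variable d : nat.
Implicit Types g : 'rV[R]_d -> R[i].

Lemma Re_iter_partial s g :
  (fun x => complex.Re (iter_partial s g x)) =
  foldr dpart (fun x => complex.Re (g x)) s.
Proof. by elim: s => //= i s <-. Qed.

Lemma Im_iter_partial s g :
  (fun x => complex.Im (iter_partial s g x)) =
  foldr dpart (fun x => complex.Im (g x)) s.
Proof. by elim: s => //= i s <-. Qed.

Lemma schwartz_bound g s : schwartz g ->
  exists C : R, forall x, `|iter_partial s g x| <= C%:C.
Proof.
move=> [_ /(_ (fun=> 0%N) s)[C hC]]; exists C => x.
by have := hC x; rewrite big1 ?mul1r// => i _; rewrite expr0.
Qed.

Lemma schwartz_Re g : schwartz g -> smooth_bounded (fun x => complex.Re (g x)).
Proof.
move=> sg s; rewrite -Re_iter_partial; split=> [x|]; first by case: (sg.1 s x).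
by have [C hC] := schwartz_bound s sg; exists C => x; exact/ler_norm_Re/hC.
Qed.

Lemma schwartz_Im g : schwartz g -> smooth_bounded (fun x => complex.Im (g x)).
Proof.
move=> sg s; rewrite -Im_iter_partial; split=> [x|]; first by case: (sg.1 s x).
by have [C hC] := schwartz_bound s sg; exists C => x; exact/ler_norm_Im/hC.
Qed.

End components.

(** With p = pi^(d/2) the factors are the constant of the theorem and the total
    mass of the weight. *)
Lemma normalization (R : realType) (a s p : R) : 0 < a < 1 -> 0 < s < 1 -> 0 < p ->
  s * sin (a * pi) * Gamma a / (p * sin (s * pi) * Gamma (1 - s)) *
  (p * Gamma (1 - a) / (s * Gamma s)) = 1.
Proof.
move=> a01 s01 p0; have ra := Gamma_reflection a01; have rs := Gamma_reflection s01.
have s0 : s != 0 by case/andP: s01 => s0 _; rewrite gt_eqF.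
rewrite [a * pi]mulrC [s * pi]mulrC.
have pi0 : pi != 0 :> R by rewrite gt_eqF ?pi_gt0.
rewrite -rs in pi0; move: pi0; rewrite !mulf_eq0 !negb_or => /andP[/andP[S0 G0] G1].
transitivity ((sin (pi * a) * Gamma a * Gamma (1 - a)) /
  (sin (pi * s) * Gamma s * Gamma (1 - s))).
  move: (sin (pi * a)) (sin (pi * s)) (Gamma a) (Gamma s) (Gamma (1 - a))
    (Gamma (1 - s)) S0 G0 G1 => A S Ga Gs Ga' Gs' S0 G0 G1.
  by field; rewrite S0 G0 G1 s0 gt_eqF.
by rewrite ra rs divff// gt_eqF ?pi_gt0.
Qed.

Theorem theorem2 (R : realType) (d : nat) (sigma : R)
  (hd : d \in [:: 1; 2; 3]%N)
  (hsigma : 0 < sigma < 1)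
  (hdsigma : 0 < d%:R / 2 - sigma < 1)
  (g : 'rV[R]_d -> R[i]) (hg : schwartz g) :
  let a := d%:R / 2 - sigma in
  let c := sigma * sin (a * pi) * Gamma a /
           (pi `^ (d%:R / 2) * sin (sigma * pi) * Gamma (1 - sigma)) in
  let integrand x t y := g y / ((t ^+ 2 - eucl_norm (x - y) ^+ 2) `^ a)%:C in
  let u x t := c%:C * cintegral (eucl_ball x t) (integrand x t) in
  (forall x t, 0 < t -> cintegrable (eucl_ball x t) (integrand x t)) /\
  neumann_solution sigma g u.
Proof.
move=> a c integrand u.
have /andP[a0 a1] := hdsigma; have /andP[sigma0 sigma1] := hsigma.
rewrite -/a in a0 a1 hdsigma.
have sE : d%:R / 2 - a = sigma by rewrite /a; ring.
have qE : d%:R - 2 * a = 2 * sigma by rewrite /a; field.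
have q0 : 0 < d%:R - 2 * a by rewrite qE mulr_gt0.
have s01 : 0 < d%:R / 2 - a < 1 by rewrite sE.
have eK := @integral_weight R d a a1 s01.
have iw : (lebesgue_tuple d).-integrable setT (EFin \o @weight R (- a) d).
  apply/integrableP; split; first by apply/measurable_EFinP; exact: measurable_weight.
  under eq_integral do rewrite gee0_abs ?lee_fin ?weight_ge0//.
  by rewrite eK ltry.
have cK : c * \int[lebesgue_tuple d]_z weight (- a) z = 1.
  rewrite /Rintegral eK/= sE /c normalization// powR_gt0// pi_gt0//.
have sRe := schwartz_Re hg; have sIm := schwartz_Im hg.
set gr := (fun x => complex.Re (g x)) in sRe; set gi := (fun x => complex.Im (g x)) in sIm.
have uE : u = fun x t => solution a c gr x t +i* solution a c gi x t.
  apply/funext => x; apply/funext => t; rewrite /u mul_real_complex /cintegral /=.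
  rewrite /solution; congr (_ +i* _); congr (_ * _); apply: eq_Rintegral => y _.
    exact: Re_div_real.
  exact: Im_div_real.
split.
  move=> x t t0; split.
    move: (ball_integral iw x sRe t0).1; congr (integrable _ _ _).
    by apply/funext => y; rewrite /= Re_div_real.
  move: (ball_integral iw x sIm t0).1; congr (integrable _ _ _).
  by apply/funext => y; rewrite /= Im_div_real.
rewrite uE; split.
- move=> x t t0; split.
  + split; [by case: (is_derive_solution c iw sRe x t0)|
            by case: (is_derive_solution c iw sIm x t0)].
  + split; [by case: (is_derive_solution_dt c iw sRe x t0)|
            by case: (is_derive_solution_dt c iw sIm x t0)].
  + by move=> i; split; [exact: (@derivable_solution_space R d a c iw gr sRe x t i t0)|
                         exact: (@derivable_solution_space R d a c iw gi sIm x t i t0)].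
  + by move=> i; split; [exact: (@derivable_dpart_solution R d a c iw gr sRe x t i t0)|
                         exact: (@derivable_dpart_solution R d a c iw gi sIm x t i t0)].
- move=> x t t0; rewrite mul_real_complex /laplacian.
  have wRe := solution_wave c a1 iw sRe x t0.
  have wIm := solution_wave c a1 iw sIm x t0.
  rewrite qE in wRe wIm.
  apply/eqP; rewrite eq_complex Re_sum Im_sum.
  by apply/andP; split; apply/eqP; [exact: wRe|exact: wIm].
- by move=> x; split; [exact: (@cvg_solution0 R d a c q0 iw gr sRe x)|
                       exact: (@cvg_solution0 R d a c q0 iw gi sIm x)].
- move=> x.
  have lRe := @cvg_solution_dt0 R d a c q0 iw gr sRe x.
  have lIm := @cvg_solution_dt0 R d a c q0 iw gi sIm x.
  rewrite cK (mulr1 (gr x)) qE in lRe; rewrite cK (mulr1 (gi x)) qE in lIm.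
  split; rewrite /dt_sigma; under eq_fun do rewrite mul_real_complex.
    exact: lRe.
  exact: lIm.
Qed.
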